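(* Consider the random process $\{\boldsymbol{x}(t)\}_{t\in\mathbb{Z}_{\ge 0}}$ in $[0,1]^{|\mathcal{V}|}$ defined by $$\boldsymbol{x}(t+1)=\boldsymbol{\Lambda}\boldsymbol{P}(t)\boldsymbol{x}(t)+(\boldsymbol{I}-\boldsymbol{\Lambda})\boldsymbol{\eta}(t),\qquad \boldsymbol{\eta}(t)=\boldsymbol{\eta}^0+\boldsymbol{\eta}^{\mathrm{nc}}(t)+\boldsymbol{u}(t),$$ where $\boldsymbol{P}(t)=\boldsymbol{P}$ with probability $\alpha$ and $\boldsymbol{P}(t)=\boldsymbol{I}$ with probability $1-\alpha$, and let $\boldsymbol{u}(t)=\boldsymbol{0}$ for all $t\in\mathbb{Z}_{\ge 0}$. Suppose Assumption (Noise) and Assumption (Topology), as spelled out in the context, hold. Then: 1. $\boldsymbol{x}(t)$ converges in distribution to a random vector $\boldsymbol{x}_\infty$, and the distribution of $\boldsymbol{x}_\infty$ is the unique invariant distribution for the dynamics $\boldsymbol{x}(t+1)=\boldsymbol{\Lambda}\boldsymbol{P}(t)\boldsymbol{x}(t)+(\boldsymbol{I}-\boldsymbol{\Lambda})(\boldsymbol{\eta}^0+\boldsymbol{\eta}^{\mathrm{nc}}(t))$. 2. The process $\{\boldsymbol{x}(t)\}$ is ergodic. 3. $\mathbb{E}[\boldsymbol{x}_\infty]=\boldsymbol{x}^\star$, where $\boldsymbol{x}^\star=(\boldsymbol{I}-\boldsymbol{\Lambda}\overline{\boldsymbol{P}})^{-1}(\boldsymbol{I}-\boldsymbol{\Lambda})\boldsymbol{\eta}^0$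 and $\overline{\boldsymbol{P}}=(1-\alpha)\boldsymbol{I}+\alpha\boldsymbol{P}$.
   Context: Model. $\mathcal{V}$ is a finite set of agents with $|\mathcal{V}|\ge 3$; $\boldsymbol{P}\in\mathbb{R}^{|\mathcal{V}|\times|\mathcal{V}|}$ is a row-stochastic (nonnegative entries, $\boldsymbol{P}\boldsymbol{1}=\boldsymbol{1}$) influence matrix; the directed graph has an edge $(v,w)$ when $P_{vw}>0$ ($v$ is influenced by $w$). $\boldsymbol{\Lambda}$ is diagonal with entries $\lambda_v\in[0,1]$, $\alpha\in[0,1]$, $\boldsymbol{\eta}^0\in[0,1]^{|\mathcal{V}|}$ is a deterministic vector of individual biases, $\boldsymbol{\eta}^{\mathrm{nc}}(t)$ is a random uncontrollable input and $\boldsymbol{u}(t)$ a control input, with $\boldsymbol{\eta}(t)\in[0,1]^{|\mathcal{V}|}$. The initial condition is $\boldsymbol{x}(0)\in[0,1]^{|\mathcal{V}|}$. The matrices $\boldsymbol{P}(t)$ are drawn independently over $t$, independently of the inputs $\boldsymbol{\eta}^{\mathrm{nc}}$ and of the initial condition. Assumption (Noise): the vectors $\boldsymbol{\eta}^{\mathrm{nc}}(t)$, $t\in\mathbb{Z}_{\ge0}$, are independent and identically distributed over $t$, with components independent across agents, zero mean and covariance $\mathrm{diag}(\sigma_v^2)_{v\in\mathcal{V}}$, and $\boldsymbol{\eta}^{\mathrm{nc}}(t)$ is independent of the state $\boldsymbol{x}(t)$. Assumption (Topology): for every $v\in\mathcal{V}$ there exists a path in the graph from $v$ to some node $s\in\mathcal{V}$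 with $\lambda_s<1$. Ergodicity: a process $\{\boldsymbol{x}(t)\}_{t\in\mathbb{Z}_{\ge0}}$ is ergodic if there is a random variable $\boldsymbol{x}_\infty$ such that $\lim_{t\to\infty}\frac1t\sum_{\ell=0}^{t-1}\boldsymbol{x}(\ell)=\mathbb{E}[\boldsymbol{x}_\infty]$ almost surely (here with the $\boldsymbol{x}_\infty$ of item 1).
   Formalization: When α = 0, all λ_v are assumed < 1. Otherwise P(t) = I almost surely and an agent with λ_v = 1 keeps x_v(0) forever, so I − ΛP̄ is singular, x* is undefined and the invariant distribution is not unique. *)

(* Defs.v *)
From HB Require Import structures.
From mathcomp Require Import all_boot all_order all_algebra.
From mathcomp Require Import finmap.
From mathcomp Require Import all_classical all_reals all_analysis.

Set Implicit Arguments.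
Unset Strict Implicit.
Unset Printing Implicit Defensive.
Import Order.TTheory GRing.Theory Num.Theory.
Import numFieldNormedType.Exports.
Local Open Scope classical_set_scope.
Local Open Scope ring_scope.

(* Real matrices (hence vectors) carry the Borel sigma-algebra of the
   entrywise topology. *)
HB.instance Definition _ (R : realType) (m n : nat) :=
  @isMeasurable.Build (sigma_display (@open 'M[R]_(m, n))) 'M[R]_(m, n)
    <<s (@open 'M[R]_(m, n)) >> (@sigma_algebra0 _ setT open)
    (@sigma_algebraC _ open) (@sigma_algebra_bigcup _ setT open).

Section Independence.
Context {d : measure_display} {Omega : measurableType d} {R : realType}
  (P : probability Omega R).

Definition mutually_independent (I : choiceType)
    (F : I -> set (set Omega)) : Prop :=
  forall (J : {fset I}) (A : I -> set Omega),
    (forall j, j \in J -> F j (A j)) ->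
    P (\bigcap_(j in [set` J]) A j) = (\prod_(j <- J) P (A j))%E.

Definition independent (F G : set (set Omega)) : Prop :=
  forall A B, F A -> G B -> P (A `&` B) = (P A * P B)%E.

Definition sigma_process {d' : measure_display} {T : measurableType d'}
    (X : nat -> Omega -> T) : set (set Omega) :=
  <<s \bigcup_t g_sigma_algebra_preimage (X t) >>.

End Independence.

Section RandomVectors.
Context {d : measure_display} {Omega : measurableType d} {R : realType}
  (P : probability Omega R) {n : nat}.

Definition coordinate (X : Omega -> 'cV[R]_n) (v : 'I_n) : Omega -> R :=
  fun w => X w v 0.

(* An equality in the extended reals: it forces each coordinate of X to be
   integrable. *)
Definition has_mean (X : Omega -> 'cV[R]_n) (m : 'cV[R]_n) : Prop :=
  forall v, 'E_P[coordinate X v]%E = (m v 0)%:E.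

Definition cvg_in_distribution (X : nat -> Omega -> 'cV[R]_n)
    (Y : Omega -> 'cV[R]_n) : Prop :=
  forall f : 'cV[R]_n -> R, continuous f -> (exists M, forall y, `|f y| <= M) ->
    'E_P[fun w => f (X t w)]%E @[t --> \oo] --> 'E_P[fun w => f (Y w)]%E.

Definition ergodic (X : nat -> Omega -> 'cV[R]_n)
    (Y : Omega -> 'cV[R]_n) : Prop :=
  exists2 m : 'cV[R]_n, has_mean Y m &
    {ae P, forall w, t%:R^-1 *: (\sum_(l < t) X l w) @[t --> \oo] --> m}.

End RandomVectors.

Section OpinionDynamics.
Context {d : measure_display} {Omega : measurableType d} {R : realType}
  (P : probability Omega R) {n : nat}.

Definition row_stochastic (W : 'M[R]_n) : Prop :=
  (forall v w, 0 <= W v w) /\ W *m const_mx 1 = const_mx 1 :> 'cV[R]_n.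

Definition influence_edge (W : 'M[R]_n) : rel 'I_n := fun v w => 0 < W v w.

Definition topology_assumption (W : 'M[R]_n) (lam : 'rV[R]_n) : Prop :=
  forall v, exists2 s, connect (influence_edge W) v s & lam 0 s < 1.

Definition in_unit_cube (y : 'cV[R]_n) : Prop := forall v, 0 <= y v 0 <= 1.

Definition opinion_step (lam : 'rV[R]_n) (M : 'M[R]_n) (y e : 'cV[R]_n) :
    'cV[R]_n :=
  diag_mx lam *m M *m y + (1%:M - diag_mx lam) *m e.

Record noise_assumption (noise x : nat -> {RV P >-> 'cV[R]_n})
    (sigma : 'I_n -> R) : Prop := NoiseAssumption {
  noise_indep_time :
    mutually_independent P (fun t => g_sigma_algebra_preimage (noise t));
  noise_ident_distr : forall t A, measurable A ->
    distribution P (noise t) A = distribution P (noise 0%N) A;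
  noise_indep_agents : forall t,
    mutually_independent P
      (fun v : 'I_n => g_sigma_algebra_preimage (coordinate (noise t) v));
  noise_mean : forall t, has_mean P (noise t) 0;
  noise_covariance : forall t u v,
    covariance P (coordinate (noise t) u) (coordinate (noise t) v) =
    (diag_mx (\row_i sigma i ^+ 2) u v)%:E;
  noise_indep_state : forall t,
    independent P (g_sigma_algebra_preimage (noise t))
      (g_sigma_algebra_preimage (x t)) }.

Record random_influence (W : 'M[R]_n) (alpha : R)
    (Pt : nat -> {RV P >-> 'M[R]_n}) (noise : nat -> {RV P >-> 'cV[R]_n})
    (x0 : {RV P >-> 'cV[R]_n}) : Prop := RandomInfluence {
  influence_law : forall t A, measurable A ->
    distribution P (Pt t) A =
    (alpha%:E * \d_W A + (1 - alpha)%:E * \d_(1%:M : 'M[R]_n) A)%E;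
  influence_indep_time :
    mutually_independent P (fun t => g_sigma_algebra_preimage (Pt t));
  influence_indep_noise :
    independent P (sigma_process Pt) (sigma_process noise);
  influence_indep_init :
    independent P (sigma_process Pt) (g_sigma_algebra_preimage x0) }.

(* The kernel y |-> law of opinion_step at time t from y.  Integrating it
   against mu amounts to drawing the state from mu independently of the pair
   (Pt t, noise t). *)
Definition transition (lam : 'rV[R]_n) (eta0 : 'cV[R]_n)
    (Pt : nat -> {RV P >-> 'M[R]_n}) (noise : nat -> {RV P >-> 'cV[R]_n})
    (t : nat) (y : 'cV[R]_n) (A : set 'cV[R]_n) : \bar R :=
  P [set w | A (opinion_step lam (Pt t w) y (eta0 + noise t w))].

Definition invariant_distribution (lam : 'rV[R]_n) (eta0 : 'cV[R]_n)
    (Pt : nat -> {RV P >-> 'M[R]_n}) (noise : nat -> {RV P >-> 'cV[R]_n})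
    (mu : probability 'cV[R]_n R) : Prop :=
  forall t A, measurable A ->
    (\int[mu]_y transition lam eta0 Pt noise t y A = mu A)%E.

End OpinionDynamics.

(* Main.v *)
(* The step [y |-> Lambda P(t) y + (I - Lambda) eta(t)] is a random affine map,
   and these maps are i.i.d.  Composing the first [k] of them backwards, starting
   from 0, gives a sequence that increases in the unit cube and so converges
   surely; its limit [stationary] has an invariant law.  Forward and backward
   compositions from a fixed point have the same law, because both are given by
   the [k]-th iterate of the one-step transfer operator.  The forward products
   applied to the all-ones vector have nonincreasing norm and mean
   [(Lambda Wbar)^k 1], which tends to 0 because [Lambda Wbar] has no nonzero
   fixed vector (maximum principle along a path to an agent with [lambda < 1]).
   Hence these products vanish almost surely and the initial condition is
   forgotten, whatever its dependence on the noise: this gives convergence in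
   distribution and uniqueness.  For ergodicity, [x(t+1)] differs from its
   conditional mean given the past by bounded orthogonal terms, whose averages
   vanish almost surely (second moments along the squares), so that the averages
   of [x] satisfy the fixed point equation of [x*] in the limit. *)
Require Import Defs.
From HB Require Import structures.
From mathcomp Require Import all_boot all_order all_algebra.
From mathcomp Require Import finmap.
From mathcomp Require Import all_classical all_reals all_analysis.
From mathcomp Require Import measurable_realfun ring lra zify.

Set Implicit Arguments.
Unset Strict Implicit.
Unset Printing Implicit Defensive.
Import Order.TTheory GRing.Theory Num.Theory.
Import numFieldNormedType.Exports.
Local Open Scope classical_set_scope.
Local Open Scope ring_scope.

(** * Random vectors and their laws *)

(** Expectations are therefore computed along the trajectory started from 0, a function of the draws
    alone, and reach [x] through a pathwise comparison that holds outside a single null set for all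
    starting points at once. The same null set serves uniqueness, where an invariant law is an
    arbitrary probability on the whole space and need not be carried by the cube. Monotonicity
    replaces spectral radii and rates of convergence: the mean iterates decrease, the norms of the
    random products decrease, and the backward compositions increase. The limit vector is built on
    the given [Omega]. Laws are compared through bounded continuous test functions, the only form in
    which the convergence of the backward compositions passes to expectations. *)

Section MatrixMeasurability.
Context {R : realType}.

Lemma continuous_measurable_mx m n (f : 'M[R]_(m, n) -> R) :
  continuous f -> measurable_fun setT f.
Proof.
move=> /continuousP cf; apply: (measurability _ (RGenOpens.measurableE R)).
move=> _ [_ [a [b ->] <-]]; rewrite setTI.
by apply: sub_sigma_algebra; apply: cf; exact: interval_open.
Qed.

Lemma measurable_coord (m n : nat) (i : 'I_m) (j : 'I_n) :
  measurable_fun setT (fun M : 'M[R]_(m, n) => M i j).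
Proof. by apply: continuous_measurable_mx; exact: coord_continuous. Qed.

(** An open set is the countable union of the balls it contains with rational centre and radius
    1/(k+1), and a ball of the entrywise norm is a finite intersection of conditions on single
    entries. *)
Lemma measurable_mx d (T : measurableType d) m n (f : T -> 'M[R]_(m, n)) :
  (forall i j, measurable_fun setT (fun t => f t i j)) ->
  measurable_fun setT f.
Proof.
move=> mf; apply: (measurability (@open 'M[R]_(m, n)) erefl).
move=> _ [U oU <-]; rewrite setTI.
pose ratmx (q : 'M[rat]_(m, n)) : 'M[R]_(m, n) := map_mx ratr q.
pose B (p : 'M[rat]_(m, n) * nat) := ball (ratmx p.1) (p.2.+1%:R^-1 : R).
(* Balls that leave [U] contribute the empty set, so that the union runs over a whole countable
   type. *)
pose D (p : 'M[rat]_(m, n) * nat) := if pselect (B p `<=` U) then f @^-1` B p else set0.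
have -> : f @^-1` U = \bigcup_p D p.
  apply/seteqP; split=> [t Ut|t [p _]]; last first.
    by rewrite /D; case: pselect => // BU /BU.
  have /nbhs_ballP[e /= e0 eU] : nbhs (f t) U by apply: open_nbhs_nbhs.
  have [k ke] : exists k, (k.+1%:R^-1 : R) < e / 2.
    exists (Num.truncn (e / 2)^-1); rewrite invf_plt ?posrE ?divr_gt0 //.
    by have := truncnS_gt (e / 2)^-1.
  pose a : R := k.+1%:R^-1.
  have a0 : 0 < a by rewrite invr_gt0.
  have /choice[q hq] : forall p : 'I_m * 'I_n,
      exists q : rat, ratr q \in `](f t p.1 p.2 - a), (f t p.1 p.2 + a)[.
    by move=> p; apply: rat_in_itvoo; rewrite ltrD2l gtrN.
  pose p := (\matrix_(i, j) q (i, j), k).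
  have Bp : B p (f t).
    split=> [//|i j]; rewrite /ratmx !mxE /ball_/=.
    by have := hq (i, j); rewrite in_itv/= -ltr_distlC distrC.
  exists p => //; rewrite /D; case: pselect => //; case.
  move=> z Bz; apply: eU.
  apply: (@le_ball _ _ _ (a + a)); first by rewrite [leRHS]splitr lerD// ltW.
  by apply: (@ball_triangle _ _ (ratmx p.1)) => //; exact: ball_sym.
apply: countable_bigcupT_measurable.
  exact: countableP.
move=> p; have [->|->] : D p = f @^-1` B p \/ D p = set0; last exact: measurable0.
  by rewrite /D; case: pselect => ?; [left|right].
have -> : f @^-1` B p = \bigcap_(ij : 'I_m * 'I_n)
    ((fun t => f t ij.1 ij.2) @^-1` ball (ratmx p.1 ij.1 ij.2) (p.2.+1%:R^-1 : R)).
  apply/seteqP; split=> [t [_ h] ij _|t h]; first exact: h.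
  by split=> [//|i j]; exact: (h (i, j)).
apply: fin_bigcap_measurable => // ij _.
by rewrite -[X in measurable X]setTI; apply: mf => //; exact: measurable_ball.
Qed.

Lemma measurable_mx_coord d (T : measurableType d) m n (f : T -> 'M[R]_(m, n)) i j :
  measurable_fun setT f -> measurable_fun setT (fun t => f t i j).
Proof. by move=> mf; exact: measurableT_comp (measurable_coord i j) mf. Qed.

Lemma measurable_mx_set1 m n (A : 'M[R]_(m, n)) : measurable [set A].
Proof.
have -> : [set A] = \bigcap_(ij : 'I_m * 'I_n)
    ((fun M : 'M[R]_(m, n) => M ij.1 ij.2) @^-1` [set A ij.1 ij.2]).
  apply/seteqP; split=> [M -> //|M h]; apply/matrixP => i j; exact: (h (i, j)).
apply: fin_bigcap_measurable => // ij _.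
by rewrite -[X in measurable X]setTI; exact: measurable_coord.
Qed.

Lemma measurable_mulmx d (T : measurableType d) m n p (A : T -> 'M[R]_(m, n))
    (B : T -> 'M[R]_(n, p)) :
  measurable_fun setT A -> measurable_fun setT B ->
  measurable_fun setT (fun t => A t *m B t).
Proof.
move=> mA mB; apply: measurable_mx => i j.
under eq_fun do rewrite mxE.
by apply: measurable_sum => k; apply: measurable_funM; exact: measurable_mx_coord.
Qed.

Lemma measurable_addmx d (T : measurableType d) m n (A B : T -> 'M[R]_(m, n)) :
  measurable_fun setT A -> measurable_fun setT B ->
  measurable_fun setT (fun t => A t + B t).
Proof.
move=> mA mB; apply: measurable_mx => i j.
under eq_fun do rewrite mxE.
by apply: measurable_funD; exact: measurable_mx_coord.
Qed.

End MatrixMeasurability.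

Section LawsOnMatrices.
Context {R : realType}.

(** The function is the distance to the complement of [U], which vanishes exactly on that closed
    set. *)
Lemma open_positivity_set m n (U : set 'M[R]_(m, n)) :
  open U -> exists h : 'M[R]_(m, n) -> R,
    [/\ continuous h, forall y, 0 <= h y & forall y, U y <-> 0 < h y].
Proof.
(* The distance to an empty complement would be infinite; the constant 1 takes its place. *)
move=> oU; have [U0|/set0P[a0 Ua0]] := eqVneq (~` U) set0.
  exists (fun=> 1); split=> //; first exact: cst_continuous.
  by move=> y; split=> // _; apply: contrapT => Uy; rewrite -[False]/(set0 y) -U0.
have dfin y : edist_inf (~` U) y \is a fin_num.
  rewrite ge0_fin_numE ?edist_inf_ge0//; apply: (@le_lt_trans _ _ (edist (y, a0))).
    by apply: ereal_inf_lbound; exists a0.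
  rewrite -ge0_fin_numE ?edist_ge0//; apply/edist_finP.
  by exists (`|y - a0| + 1); rewrite ?ltr_wpDl// mx_norm_ball /ball_/= ltrDl.
exists (fun y => fine (edist_inf (~` U) y)); split.
- move=> y; have := @edist_inf_continuous R 'M[R]_(m, n) (~` U) y.
  by rewrite /continuous_at -(fineK (dfin y)) => /fine_cvg.
- by move=> y; rewrite fine_ge0// edist_inf_ge0.
move=> y; rewrite -lte_fin fineK//; split=> [Uy|].
  have /nbhs_ballP[e /= e0 eU] : nbhs y U by exact: open_nbhs_nbhs.
  apply: (@lt_le_trans _ _ e%:E); first by rewrite lte_fin.
  apply: le_ereal_inf_tmp => _ [z Uz <-]; rewrite leNgt; apply/negP.
  by move=> /edist_lt_ball/eU.
move=> y0; apply: contrapT => Uy.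
by move: y0; rewrite (edist_inf0 Uy) ltxx.
Qed.

(** Open sets form a generating family closed under intersection, and the indicator of an open set
    is the increasing limit of the continuous functions [min 1 (k * h)], with [h] from
    [open_positivity_set]. *)
Lemma probability_mx_eq m n (mu nu : probability 'M[R]_(m, n) R) :
  (forall f : 'M[R]_(m, n) -> R, continuous f -> (forall y, 0 <= f y <= 1) ->
    (\int[mu]_y (f y)%:E = \int[nu]_y (f y)%:E)%E) ->
  forall A, measurable A -> mu A = nu A.
Proof.
move=> mu_nu; apply: (measure_unique (@open 'M[R]_(m, n)) (fun=> setT)) => //.
- by move=> A B; exact: openI.
- by move=> _; exact: openT.
- by rewrite bigcup_const.
- move=> U oU; have [h [ch h0 Uh]] := open_positivity_set oU.
  pose g (k : nat) (y : 'M[R]_(m, n)) : R := Num.min 1 (k%:R * h y).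
  have cg k : continuous (g k).
    move=> y; apply: (@continuous_min _ _ (cst 1) (fun y => k%:R * h y)).
      exact: cst_continuous.
    by apply: continuousM; [exact: cst_continuous|exact: ch].
  have g01 k y : 0 <= g k y <= 1.
    by rewrite le_min ge_min lexx ler01 mulr_ge0.
  have mg k : measurable_fun setT (EFin \o g k).
    by apply/measurable_EFinP; exact: continuous_measurable_mx.
  have gU y : (g k y)%:E @[k --> \oo] --> ((\1_U y)%:E : \bar R).
    apply: cvg_EFin; first exact: nearW.
    rewrite indicE; have [/set_mem/Uh y0|/negP yU] := boolP (y \in U).
      apply: cvg_near_cst; near=> k; rewrite /= /g min_l// -ler_pdivrMr// mul1r.
      by near: k; exact: nbhs_infty_ger.
    suff y0 : h y = 0.
      by apply: cvg_near_cst; apply: nearW => k; rewrite /= /g y0 mulr0 min_r.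
    apply/eqP; rewrite eq_le h0 andbT leNgt; apply/negP => /Uh Uy.
    by apply: yU; rewrite inE.
  have key (la : probability 'M[R]_(m, n) R) :
      (\int[la]_y (g k y)%:E @[k --> \oo] --> la U)%E.
    have <- : (\int[la]_x (limn (fun k => (g k x)%:E)) = la U)%E.
      rewrite -[in RHS](setIT U) -integral_indic//; last exact: sub_sigma_algebra.
      by apply: eq_integral => x _; apply/cvg_lim => //; exact: gU.
    apply: cvg_monotone_convergence => //.
      by move=> k y _; rewrite lee_fin; case/andP: (g01 k y).
    move=> y _ a b ab; rewrite lee_fin le_min ge_min lexx/= ge_min.
    by rewrite ler_wpM2r ?orbT// ler_nat.
  have := key mu; under eq_fun do rewrite mu_nu//.
  by move=> mulim; exact: (cvg_unique (@ereal_hausdorff R) mulim (key nu)).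
- by move=> _; rewrite (le_lt_trans (probability_le1 _ _))// ltry.
Unshelve. all: by end_near. Qed.

Lemma compact_unit_cube n : compact (@in_unit_cube R n).
Proof.
have -> : @in_unit_cube R n = [set trmx v | v in
    [set v : 'rV[R]_n | forall i, v ord0 i \in `[0, 1]]].
  apply/seteqP; split => [y hy|_ [v hv <-] i].
    by exists y^T; rewrite ?trmxK// => i; rewrite mxE in_itv/=; exact: hy.
  by rewrite mxE; have := hv i; rewrite in_itv.
apply: continuous_compact.
  apply: continuous_subspaceT => v U /= /nbhs_ballP[e /= e0 eU].
  apply/nbhs_ballP; exists e => //= z [_ hz]; apply: eU; split=> // i j.
  by rewrite !mxE.
apply: (@rV_compact R n (fun=> `[(0 : R), 1]%classic)).
by move=> _; exact: segment_compact.
Qed.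

(** Only [b] is confined to the compact set: [f] is continuous uniformly at the points of [K]
    against arbitrary small perturbations, so [a] may stay outside [K]. *)
Lemma continuous_sub_cvg0 n (K : set 'cV[R]_n) (f : 'cV[R]_n -> R)
    (a b : nat -> 'cV[R]_n) :
  compact K -> continuous f -> (forall k, K (b k)) ->
  a k - b k @[k --> \oo] --> (0 : 'cV[R]_n) ->
  f (a k) - f (b k) @[k --> \oo] --> (0 : R).
Proof.
move=> /compact_near_coveringP cK cf Kb ab0; apply/cvgrPdist_lt => e e0.
have {}cK := cK _ (nbhs (0 : 'cV[R]_n)) (fun z y => `|f y - f (y + z)| < e) _.
have K0 : \forall z \near (0 : 'cV[R]_n), K `<=` (fun y => `|f y - f (y + z)| < e).
  apply: cK => y _.
  have e20 : 0 < e / 2 by rewrite divr_gt0.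
  have /cvgrPdist_lt/(_ _ e20)/nbhs_ballP[r /= r0 hr] := cf y.
  have r20 : 0 < r / 2 by rewrite divr_gt0.
  exists (ball y (r / 2), ball 0 (r / 2)); first by split; exact: nbhsx_ballx.
  move=> [y' z] /= [yy' zz].
  have hz : ball y r (y' + z).
    rewrite mx_norm_ball /ball_/= opprD addrA (le_lt_trans (ler_normB _ _))//.
    rewrite [r]splitr ltrD//; first by move: yy'; rewrite mx_norm_ball.
    by move: zz; rewrite mx_norm_ball /ball_/= sub0r normrN.
  have hy' : ball y r y' by apply: le_ball yy'; rewrite [leRHS]splitr lerDl ltW.
  rewrite (_ : _ - _ = (f y - f (y' + z)) - (f y - f y')); last by ring.
  rewrite (le_lt_trans (ler_normB _ _))// [e]splitr ltrD//; exact: hr.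
near=> k; rewrite sub0r opprB.
have : K `<=` (fun y => `|f y - f (y + (a k - b k))| < e).
  by near: k; exact: (ab0 _ K0).
by move=> /(_ _ (Kb k)); rewrite [b k + _]addrC subrK.
Unshelve. all: by end_near. Qed.

End LawsOnMatrices.

(** * Independence *)

Section Independence.
Context d (Omega : measurableType d) (R : realType) (P : probability Omega R).

Lemma independent_sym (G H : set (set Omega)) :
  independent P G H -> independent P H G.
Proof. by move=> GH A B HA GB; rewrite setIC muleC; exact: GH. Qed.

(** For fixed [B], both sides are finite measures in [A] that agree on the intersection-stable
    family [G], hence on the sigma-algebra it generates. *)
Lemma independent_sigmal (G H : set (set Omega)) :
  G `<=` measurable -> H `<=` measurable -> setI_closed G -> G setT ->
  independent P G H -> independent P <<s G >> H.
Proof.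
move=> mG mH GI GT GH A B GA HB.
have mB := mH _ HB.
have PB0 : 0 <= fine (P B) by exact: fine_ge0.
rewrite -[P B]fineK ?fin_num_measure// muleC.
rewrite -[LHS]/(mrestr P mB A) -[RHS]/(mscale (NngNum PB0) P A).
apply: (g_sigma_algebra_measure_unique G _ (fun=> setT)) => //.
- by rewrite bigcup_const.
- move=> C GC; transitivity (P C * P B)%E; first exact: GH.
  by rewrite muleC -{1}[P B]fineK// fin_num_measure.
- move=> k; rewrite /mrestr.
  by rewrite (le_lt_trans (probability_le1 _ _))// ?ltry// setTI.
Qed.

Lemma independent_sigma (G H : set (set Omega)) :
  G `<=` measurable -> H `<=` measurable -> setI_closed G -> setI_closed H ->
  G setT -> H setT -> independent P G H -> independent P <<s G >> <<s H >>.
Proof.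
move=> mG mH GI HI GT HT GH; apply: independent_sym.
apply: independent_sigmal => //.
  by apply: smallest_sub => //; exact: sigma_algebra_measurable.
by apply: independent_sym; exact: independent_sigmal.
Qed.

(** By uniqueness of the product measure on rectangles, the joint law of [X] and [Y] is the product
    of their laws; Tonelli then separates the integrals. *)
Lemma integral_independent d1 d2 (T1 : measurableType d1) (T2 : measurableType d2)
    (X : {RV P >-> T1}) (Y : {RV P >-> T2}) (h : T1 * T2 -> \bar R) :
  (forall A B, measurable A -> measurable B ->
    P (X @^-1` A `&` Y @^-1` B) = P (X @^-1` A) * P (Y @^-1` B))%E ->
  measurable_fun setT h -> (forall z, 0 <= h z)%E ->
  (\int[P]_w h (X w, Y w) =
   \int[distribution P Y]_y \int[distribution P X]_x h (x, y))%E.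
Proof.
move=> XY mh h0.
have mXY : measurable_fun setT (fun w => (X w, Y w)) by exact: measurable_fun_pair.
pose Z : {mfun Omega >-> (T1 * T2)%type} := HB.pack (fun w => (X w, Y w))
  (isMeasurableFun.Build _ _ _ _ _ mXY).
transitivity (\int[distribution P Z]_z h z)%E.
  by rewrite ge0_integral_distribution.
transitivity (\int[distribution P X \x distribution P Y]_z h z)%E.
  apply: eq_measure_integral => A mA _.
  by apply/esym/product_measure_unique => //= B C mB mC; rewrite -XY.
by rewrite fubini_tonelli2.
Qed.

Lemma tonelli_independent d1 d2 (T1 : measurableType d1) (T2 : measurableType d2)
    (X : Omega -> T1) (Y : Omega -> T2) (h : T1 * T2 -> \bar R) :
  measurable_fun setT X -> measurable_fun setT Y ->
  (forall A B, measurable A -> measurable B ->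
    P (X @^-1` A `&` Y @^-1` B) = P (X @^-1` A) * P (Y @^-1` B))%E ->
  measurable_fun setT h -> (forall z, 0 <= h z)%E ->
  (\int[P]_w h (X w, Y w) = \int[P]_w' \int[P]_w h (X w, Y w'))%E.
Proof.
move=> mX mY XY mh h0.
pose X' : {mfun Omega >-> T1} := HB.pack X (isMeasurableFun.Build _ _ _ _ _ mX).
pose Y' : {mfun Omega >-> T2} := HB.pack Y (isMeasurableFun.Build _ _ _ _ _ mY).
rewrite (@integral_independent _ _ _ _ X' Y')//.
rewrite ge0_integral_distribution//; last 2 first.
- exact: (measurable_fun_fubini_tonelli_G (m1 := distribution P X')).
- by move=> y; apply: integral_ge0.
apply: eq_integral => w _ /=; rewrite ge0_integral_distribution//.
exact: measurable_fun_pair1.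
Qed.

End Independence.

(** Mutual independence speaks of finite index sets. The infinite intersection is one over the
    indices below [m] other than [t], and adding [t] to that set splits off one factor. *)
Lemma mutually_independent_other d (Omega : measurableType d) (R : realType)
    (P : probability Omega R) d' (T : measurableType d') (X : nat -> {RV P >-> T})
    (t m : nat) (A : nat -> set T) (B : set T) :
  mutually_independent P (fun t => g_sigma_algebra_preimage (X t)) ->
  (forall j, measurable (A j)) -> measurable B ->
  (forall j, (m <= j)%N \/ j = t -> A j = setT) ->
  (P ((\bigcap_j X j @^-1` A j) `&` X t @^-1` B) =
   P (\bigcap_j X j @^-1` A j) * P (X t @^-1` B))%E.
Proof.
move=> Xi mA mB tA.
pose J := ([fset j in iota 0 m] `\ t)%fset.
pose C j := X j @^-1` (if j == t then B else A j).
have CE j : j \in J -> C j = X j @^-1` A j.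
  by rewrite !inE /C => /andP[/negPf ->].
have FC j : g_sigma_algebra_preimage (X j) (C j).
  by exists (if j == t then B else A j); [case: ifP|rewrite setTI].
have tJ : t \notin J by rewrite !inE eqxx.
have AJ : \bigcap_j X j @^-1` A j = \bigcap_(j in [set` J]) C j.
  apply/seteqP; split=> [w h j Jj|w h j _]; first by rewrite CE//; exact: h.
  have [mj|jm] := leqP m j; first by rewrite tA//; left.
  have [->|jt] := eqVneq j t; first by rewrite tA//; right.
  have Jj : j \in J by rewrite !inE jt mem_iota jm.
  by rewrite -CE//; exact: h.
have Ct : C t = X t @^-1` B by rewrite /C eqxx.
have := Xi (t |` J)%fset C (fun j _ => FC j).
rewrite big_fsetU1//= -(Xi J C (fun j _ => FC j)) -AJ Ct muleC => <-.
congr (P _); rewrite setIC AJ -Ct; apply/seteqP; split=> [w [h1 h2] j|w h].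
  by rewrite /= !inE => /orP[/eqP ->//|] Jj; apply: h2; rewrite /= !inE.
split; first by apply: h; rewrite /= !inE eqxx.
by move=> j /= Jj; apply: h; rewrite /= fset1Ur.
Qed.

(** * Independence of one time from all other times, for a pair of sequences *)

Section IndependentSequences.
Context d (Omega : measurableType d) (R : realType) (P : probability Omega R).
Context d1 d2 (T1 : measurableType d1) (T2 : measurableType d2).
Variables (X : nat -> {RV P >-> T1}) (Y : nat -> {RV P >-> T2}).
Hypothesis indepX : mutually_independent P (fun t => g_sigma_algebra_preimage (X t)).
Hypothesis indepY : mutually_independent P (fun t => g_sigma_algebra_preimage (Y t)).
Hypothesis indepXY : independent P (sigma_process X) (sigma_process Y).

Definition cylinder (A : nat -> set T1) (B : nat -> set T2) : set Omega :=
  \bigcap_j (X j @^-1` A j `&` Y j @^-1` B j).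

(* The countable intersections in [cylinder] are finite here: only indices
   [j < m] are constrained. *)
Definition other_times (t : nat) : set (set Omega) :=
  [set E | exists m A B, [/\ forall j, measurable (A j), forall j, measurable (B j),
    forall j, (m <= j)%N \/ j = t -> A j = setT /\ B j = setT & E = cylinder A B]].

Definition at_time (t : nat) : set (set Omega) :=
  [set E | exists A B, [/\ measurable A, measurable B &
    E = X t @^-1` A `&` Y t @^-1` B]].

Lemma measurable_cylinder A B :
  (forall j, measurable (A j)) -> (forall j, measurable (B j)) ->
  measurable (cylinder A B).
Proof.
move=> mA mB; apply: bigcapT_measurable => j.
by apply: measurableI; exact: measurable_funPTI.
Qed.

Lemma other_times_measurable t : other_times t `<=` measurable.
Proof. by move=> _ [m [A [B [mA mB _ ->]]]]; exact: measurable_cylinder. Qed.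

Lemma other_timesI t : setI_closed (other_times t).
Proof.
move=> _ _ [m [A [B [mA mB tAB ->]]]] [m' [A' [B' [mA' mB' tAB' ->]]]].
exists (maxn m m'), (fun j => A j `&` A' j), (fun j => B j `&` B' j).
split=> [j|j|j|]; [exact: measurableI|exact: measurableI| |].
- rewrite geq_max => h.
  have [-> ->] : A j = setT /\ B j = setT by apply: tAB; case: h => [/andP[]|]; auto.
  have [-> ->] : A' j = setT /\ B' j = setT by apply: tAB'; case: h => [/andP[]|]; auto.
  by rewrite !setTI.
- rewrite /cylinder -bigcapI; apply: eq_bigcapr => j _.
  by rewrite !preimage_setI setIACA.
Qed.

Lemma other_timesT t : other_times t setT.
Proof.
exists 0%N, (fun=> setT), (fun=> setT); split=> //.
by rewrite /cylinder; under eq_bigcapr do rewrite !preimage_setT setTI;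
  rewrite bigcap_const.
Qed.

Lemma at_time_measurable t : at_time t `<=` measurable.
Proof.
by move=> _ [A [B [mA mB ->]]]; apply: measurableI; exact: measurable_funPTI.
Qed.

Lemma at_timeI t : setI_closed (at_time t).
Proof.
move=> _ _ [A [B [mA mB ->]]] [A' [B' [mA' mB' ->]]].
exists (A `&` A'), (B `&` B'); split; [exact: measurableI..|].
by rewrite !preimage_setI setIACA.
Qed.

Lemma at_timeT t : at_time t setT.
Proof. by exists setT, setT; split=> //; rewrite !preimage_setT setTI. Qed.

Lemma sigma_process_bigcap d' (T : measurableType d') (Z : nat -> {RV P >-> T})
    (A : nat -> set T) :
  (forall j, measurable (A j)) -> sigma_process Z (\bigcap_j Z j @^-1` A j).
Proof.
move=> mA.
apply: (@bigcapT_measurable _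
  (g_sigma_algebraType (\bigcup_t g_sigma_algebra_preimage (Z t)))) => j.
by apply: sub_sigma_algebra; exists j => //; exists (A j); rewrite ?setTI.
Qed.

Lemma sigma_process_preimage d' (T : measurableType d') (Z : nat -> {RV P >-> T})
    t (A : set T) :
  measurable A -> sigma_process Z (Z t @^-1` A).
Proof.
by move=> mA; apply: sub_sigma_algebra; exists t => //; exists A; rewrite ?setTI.
Qed.

(** Independence of the two processes separates the [X] part from the [Y] part; within each part,
    mutual independence over time separates time [t] from the others; the four factors are then
    regrouped. *)
Lemma independent_at_other_times t : independent P (at_time t) (other_times t).
Proof.
apply: independent_sym => _ _ [m [A [B [mA mB tAB ->]]]] [A' [B' [mA' mB' ->]]].
have tA j : (m <= j)%N \/ j = t -> A j = setT by move/tAB => [].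
have tB j : (m <= j)%N \/ j = t -> B j = setT by move/tAB => [].
have cylE : cylinder A B = (\bigcap_j X j @^-1` A j) `&` (\bigcap_j Y j @^-1` B j).
  by rewrite /cylinder bigcapI.
rewrite cylE setIACA.
have sX : sigma_process X _ := sigma_process_bigcap mA.
have sX' : sigma_process X _ := sigma_process_preimage t mA'.
have sY : sigma_process Y _ := sigma_process_bigcap mB.
have sY' : sigma_process Y _ := sigma_process_preimage t mB'.
have sI d' (T : measurableType d') (Z : nat -> {RV P >-> T}) E F :
    sigma_process Z E -> sigma_process Z F -> sigma_process Z (E `&` F).
  exact: (@measurableI _
    (g_sigma_algebraType (\bigcup_t g_sigma_algebra_preimage (Z t)))).
rewrite (indepXY (sI _ _ _ _ _ sX sX') (sI _ _ _ _ _ sY sY')).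
rewrite (indepXY sX sY) (indepXY sX' sY').
by rewrite (mutually_independent_other indepX mA mA' tA)
  (mutually_independent_other indepY mB mB' tB) muleACA.
Qed.

Lemma at_time_X t : measurable_fun (setT : set (g_sigma_algebraType (at_time t))) (X t).
Proof.
move=> _ A mA; rewrite setTI; apply: sub_sigma_algebra.
by exists A, setT; split=> //; rewrite preimage_setT setIT.
Qed.

Lemma at_time_Y t : measurable_fun (setT : set (g_sigma_algebraType (at_time t))) (Y t).
Proof.
move=> _ A mA; rewrite setTI; apply: sub_sigma_algebra.
by exists setT, A; split=> //; rewrite preimage_setT setTI.
Qed.

Lemma other_times_X t j : j <> t ->
  measurable_fun (setT : set (g_sigma_algebraType (other_times t))) (X j).
Proof.
move=> jt _ A mA; rewrite setTI; apply: sub_sigma_algebra.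
exists j.+1, (fun i => if i == j then A else setT), (fun=> setT); split=> [i|//|i h|].
- by case: ifP.
- by case: eqVneq h => // -> [|//]; rewrite ltnn.
apply/seteqP; split=> [w Aw i _|w /(_ j Logic.I)[]/=]; last by rewrite eqxx.
by split=> //=; case: eqVneq => // ->.
Qed.

Lemma other_times_Y t j : j <> t ->
  measurable_fun (setT : set (g_sigma_algebraType (other_times t))) (Y j).
Proof.
move=> jt _ A mA; rewrite setTI; apply: sub_sigma_algebra.
exists j.+1, (fun=> setT), (fun i => if i == j then A else setT); split=> [//|i|i h|].
- by case: ifP.
- by case: eqVneq h => // -> [|//]; rewrite ltnn.
apply/seteqP; split=> [w Aw i _|w /(_ j Logic.I)[_]/=]; last by rewrite eqxx.
by split=> //=; case: eqVneq => // ->.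
Qed.

Lemma measurable_sub_sigma d' (T : measurableType d') (G : set (set Omega)) (f : Omega -> T) :
  G `<=` measurable -> measurable_fun (setT : set (g_sigma_algebraType G)) f ->
  measurable_fun setT f.
Proof.
move=> mG mf _ A mA; have := mf measurableT A mA.
by apply: smallest_sub => //; exact: sigma_algebra_measurable.
Qed.

(** Serves as conditioning on all times but [t]: the draw at time [t] is integrated out with
    everything else frozen. *)
Lemma tonelli_time t d3 d4 (T3 : measurableType d3) (T4 : measurableType d4)
    (U : Omega -> T3) (V : Omega -> T4) (h : T3 * T4 -> \bar R) :
  measurable_fun (setT : set (g_sigma_algebraType (at_time t))) U ->
  measurable_fun (setT : set (g_sigma_algebraType (other_times t))) V ->
  measurable_fun setT h -> (forall z, 0 <= h z)%E ->
  (\int[P]_w h (U w, V w) = \int[P]_w' \int[P]_w h (U w, V w'))%E.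
Proof.
move=> mU mV; apply: tonelli_independent.
- by apply: measurable_sub_sigma mU; exact: at_time_measurable.
- by apply: measurable_sub_sigma mV; exact: other_times_measurable.
move=> A B mA mB.
have := independent_sigma (@at_time_measurable t) (@other_times_measurable t)
  (@at_timeI t) (@other_timesI t) (@at_timeT t) (@other_timesT t)
  (@independent_at_other_times t).
apply.
  by have := mU measurableT A mA; rewrite setTI.
by have := mV measurableT B mB; rewrite setTI.
Qed.

End IndependentSequences.

(** * Bounded random variables *)

Section BoundedRandomVariables.
Context d (Omega : measurableType d) (R : realType) (P : probability Omega R).
Implicit Types f g : Omega -> R.

Definition bounded_rv f :=
  measurable_fun setT f /\ exists M : R, forall w, `|f w| <= M.

Lemma bounded_rv_integrable f : bounded_rv f -> P.-integrable setT (EFin \o f).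
Proof.
move=> [mf [M fM]]; apply: measurable_bounded_integrable => //.
  by rewrite (le_lt_trans (probability_le1 _ _))// ltry.
exists M; split; first exact: num_real.
by move=> x Mx w _ /=; rewrite (le_trans (fM w))// ltW.
Qed.

Lemma bounded_rv_cst c : bounded_rv (fun=> c).
Proof. by split=> //; exists `|c|. Qed.

Lemma bounded_rvD f g : bounded_rv f -> bounded_rv g ->
  bounded_rv (fun w => f w + g w).
Proof.
move=> [mf [M fM]] [mg [N gN]]; split; first exact: measurable_funD.
by exists (M + N) => w; rewrite (le_trans (ler_normD _ _))// lerD.
Qed.

Lemma bounded_rvM f g : bounded_rv f -> bounded_rv g ->
  bounded_rv (fun w => f w * g w).
Proof.
move=> [mf [M fM]] [mg [N gN]]; split; first exact: measurable_funM.
by exists (M * N) => w; rewrite normrM ler_pM.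
Qed.

Lemma bounded_rv_sum (I : Type) (s : seq I) (F : I -> Omega -> R) :
  (forall i, bounded_rv (F i)) -> bounded_rv (fun w => \sum_(i <- s) F i w).
Proof.
move=> bF; elim: s => [|i s IH].
  by under eq_fun do rewrite big_nil; exact: bounded_rv_cst.
by under eq_fun do rewrite big_cons; exact: bounded_rvD.
Qed.

Lemma integral_bounded_rv f : bounded_rv f ->
  (\int[P]_w (f w)%:E)%E = (\int[P]_w f w)%:E.
Proof.
by move=> bf; rewrite fineK//; apply: integrable_fin_num => //; exact: bounded_rv_integrable.
Qed.

Lemma integral_prob_cst (c : \bar R) : (\int[P]_w c = c)%E.
Proof.
by rewrite integral_cst// -[X in (c * X)%E]/(P setT) probability_setT mule1.
Qed.

Lemma Rintegral_prob_cst c : \int[P]_w c = c.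
Proof. by rewrite /Rintegral integral_prob_cst. Qed.

Lemma Rintegral_bdD f g : bounded_rv f -> bounded_rv g ->
  \int[P]_w (f w + g w) = \int[P]_w f w + \int[P]_w g w.
Proof. by move=> bf bg; apply: RintegralD => //; exact: bounded_rv_integrable. Qed.

Lemma Rintegral_bdZ c f : bounded_rv f -> \int[P]_w (c * f w) = c * \int[P]_w f w.
Proof. by move=> bf; apply: RintegralZl => //; exact: bounded_rv_integrable. Qed.

Lemma Rintegral_bd_sum (I : Type) (s : seq I) (F : I -> Omega -> R) :
  (forall i, bounded_rv (F i)) ->
  \int[P]_w (\sum_(i <- s) F i w) = \sum_(i <- s) \int[P]_w F i w.
Proof.
move=> bF; elim: s => [|i s IH].
  by rewrite big_nil; under eq_Rintegral do rewrite big_nil; rewrite Rintegral_prob_cst.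
rewrite big_cons -IH -Rintegral_bdD//; last exact: bounded_rv_sum.
by under eq_Rintegral do rewrite big_cons.
Qed.

Lemma le_Rintegral_bd f g : bounded_rv f -> bounded_rv g ->
  (forall w, f w <= g w) -> \int[P]_w f w <= \int[P]_w g w.
Proof. by move=> bf bg fg; apply: le_Rintegral => //; exact: bounded_rv_integrable. Qed.

Lemma bounded_convergence (g : nat -> Omega -> R) (h : Omega -> R) (c : R) :
  (forall k, measurable_fun setT (g k)) -> measurable_fun setT h ->
  (forall k w, `|g k w| <= c) ->
  {ae P, forall w, g k w @[k --> \oo] --> h w} ->
  \int[P]_w g k w @[k --> \oo] --> \int[P]_w h w.
Proof.
move=> mg mh gc gh.
have bc : P.-integrable setT (EFin \o (fun=> c)).
  exact/bounded_rv_integrable/bounded_rv_cst.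
have mg' k : measurable_fun setT (EFin \o g k) by apply/measurable_EFinP.
have mh' : measurable_fun setT (EFin \o h) by apply/measurable_EFinP.
have gh' : {ae P, forall w, setT w -> (EFin \o g k) w @[k --> \oo] --> (EFin \o h) w}.
  by apply: filterS gh => w gw _; apply: cvg_EFin gw; exact: nearW.
have gc' : {ae P, forall w, forall k, setT w ->
    (`|(EFin \o g k) w| <= (EFin \o (fun=> c)) w)%E}.
  by apply: aeW => w k _; rewrite lee_fin gc.
have [ih _ cvg_int] := dominated_convergence measurableT mg' mh' gh' bc gc'.
by apply: fine_cvg; rewrite fineK//; exact: integrable_fin_num.
Qed.

(** Turns convergence of means into almost sure convergence without any rate. The monotone limit
    lies below every [N k], so it is nonnegative with zero integral and vanishes almost
    everywhere. *)
Lemma nonincreasing_ae_cvg0 (N : nat -> Omega -> R) :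
  (forall k, bounded_rv (N k)) -> (forall k w, 0 <= N k w) ->
  (forall k w, N k.+1 w <= N k w) ->
  \int[P]_w N k w @[k --> \oo] --> (0 : R) ->
  {ae P, forall w, N k w @[k --> \oo] --> (0 : R)}.
Proof.
move=> bN N0 dN cvgN.
have ndN w : {homo (N ^~ w) : n m / (n <= m)%N >-> m <= n}.
  by apply/nonincreasing_seqP => k; exact: dN.
have cN w : cvgn (N ^~ w).
  by apply: nonincreasing_is_cvgn => //; exists 0 => _ [k _ <-].
pose L w := limn (N ^~ w).
have LN k w : L w <= N k w by exact: nonincreasing_cvgn_ge.
have L0 w : 0 <= L w by apply: limr_ge; [exact: cN|exact: nearW].
have bL : bounded_rv L.
  split; first by apply: (measurable_fun_cvg (h := N)) => [k|w _]; [case: (bN k)|exact: cN].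
  have [_ [M NM]] := bN 0%N; exists M => w.
  by rewrite ger0_norm// (le_trans (LN 0%N w))// (le_trans _ (NM w))// ler_norm.
have IL : \int[P]_w L w = 0.
  apply/eqP; rewrite eq_le; apply/andP; split; last exact: Rintegral_ge0.
  rewrite -(cvg_lim _ cvgN)//; apply: limr_ge; first by apply/cvg_ex; exists 0.
  by apply: nearW => k; apply: le_Rintegral_bd.
have : ae_eq P setT (EFin \o L) (cst 0%E).
  apply/ae_eq_integral_abs => //; first by apply/measurable_EFinP; case: bL.
  under eq_integral do rewrite /= ger0_norm//.
  by rewrite integral_bounded_rv// IL.
apply: filterS => w /= /(_ Logic.I) [Lw0].
by rewrite -Lw0; exact: cN.
Qed.

(** [tonelli_time] requires a nonnegative integrand, so [f] and [g] are shifted by their bounds and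
    the product is expanded afterwards. *)
Lemma expectation_prod_independent d1 d2 (T1 : measurableType d1) (T2 : measurableType d2)
   (X : nat -> {RV P >-> T1}) (Y : nat -> {RV P >-> T2}) t f g :
  mutually_independent P (fun t => g_sigma_algebra_preimage (X t)) ->
  mutually_independent P (fun t => g_sigma_algebra_preimage (Y t)) ->
  independent P (sigma_process X) (sigma_process Y) ->
  bounded_rv f -> bounded_rv g ->
  measurable_fun (setT : set (g_sigma_algebraType (at_time X Y t))) f ->
  measurable_fun (setT : set (g_sigma_algebraType (other_times X Y t))) g ->
  \int[P]_w (f w * g w) = (\int[P]_w f w) * (\int[P]_w g w).
Proof.
move=> iX iY iXY bf bg mf mg.
have [_ [a fa]] := bf; have [_ [b gb]] := bg.
(* The absolute values make [h] nonnegative on the whole plane; along [f] and [g] they disappear. *)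
pose h (z : R * R) := (`|z.1 + a| * `|z.2 + b|)%:E.
have mh : measurable_fun setT h.
  apply/measurable_EFinP; apply: measurable_funM; apply: measurableT_comp => //;
    by apply: measurable_funD.
have := tonelli_time iX iY iXY mf mg mh (fun z => mulr_ge0 (normr_ge0 _) (normr_ge0 _)).
have fa0 w : `|f w + a| = f w + a.
  by rewrite ger0_norm// -lerBlDr sub0r; have := fa w; rewrite ler_norml => /andP[].
have gb0 w : `|g w + b| = g w + b.
  by rewrite ger0_norm// -lerBlDr sub0r; have := gb w; rewrite ler_norml => /andP[].
have bfa : bounded_rv (fun w => f w + a) by apply: bounded_rvD => //; exact: bounded_rv_cst.
have bgb : bounded_rv (fun w => g w + b) by apply: bounded_rvD => //; exact: bounded_rv_cst.
have inner w' : (\int[P]_w h (f w, g w') = ((\int[P]_w (f w + a)) * (g w' + b))%R%:E)%E.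
  rewrite /h/=; under eq_integral do rewrite fa0 gb0 mulrC.
  rewrite integral_bounded_rv; last by apply: bounded_rvM => //; exact: bounded_rv_cst.
  by rewrite Rintegral_bdZ// mulrC.
under [in RHS]eq_integral do rewrite inner.
rewrite [in RHS]integral_bounded_rv; last by apply: bounded_rvM => //; exact: bounded_rv_cst.
rewrite /h/=; under eq_integral do rewrite fa0 gb0.
rewrite integral_bounded_rv; last exact: bounded_rvM.
rewrite Rintegral_bdZ// => -[].
have -> : \int[P]_w ((f w + a) * (g w + b)) =
   \int[P]_w (f w * g w) + (b * \int[P]_w f w + (a * \int[P]_w g w + a * b)).
  rewrite -(Rintegral_prob_cst (a * b)) -!Rintegral_bdZ// -!Rintegral_bdD.
    by apply: eq_Rintegral => w _; ring.
  all: repeat (apply: bounded_rvD || apply: bounded_rvM || exact: bounded_rv_cst || assumption).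
rewrite !Rintegral_bdD// ?Rintegral_prob_cst; [|exact: bounded_rv_cst..].
by move=> h'; lra.
Qed.

End BoundedRandomVariables.

(** * A strong law for orthogonal bounded variables *)

Section SquareSubsequence.
Context {R : realType}.

Lemma square_bracket n : (0 < n)%N -> exists k, (k.+1 ^ 2 <= n < k.+2 ^ 2)%N.
Proof.
elim: n => // -[_ _|n IH _]; first by exists 0%N.
have [k /andP[kn nk]] := IH isT.
have [nk2|nk2] := ltnP n.+2 (k.+2 ^ 2)%N; first by exists k; rewrite nk2 ltnW.
exists k.+1; rewrite nk2/=; apply: (leq_ltn_trans nk).
by rewrite ltn_exp2r.
Qed.

(** Between consecutive squares the sum moves by at most [c] times the gap, which is of order k and
    hence negligible against (k+1)^2. *)
Lemma mean_cvg0_of_squares (s : nat -> R) (c : R) :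
  (forall n, `|s n.+1 - s n| <= c) ->
  s (k.+1 ^ 2)%N / (k.+1 ^ 2)%:R @[k --> \oo] --> (0 : R) ->
  n%:R^-1 * s n @[n --> \oo] --> (0 : R).
Proof.
move=> sc sq.
have c0 : 0 <= c by exact: le_trans (sc 0%N).
have sD n m : `|s (n + m)%N - s n| <= m%:R * c.
  elim: m => [|m IH]; first by rewrite addn0 subrr normr0 mul0r.
  rewrite addnS -(subrKA (s (n + m)%N)) (le_trans (ler_normD _ _))//.
  by rewrite -natr1 mulrDl mul1r addrC lerD.
apply/cvgrPdist_lt => e e0.
have e20 : 0 < e / 2 by rewrite divr_gt0.
(* The 3 comes from (k+2)^2 - (k+1)^2 = 2k + 3 <= 3(k+1). *)
have hc : 3 * c * k.+1%:R^-1 @[k --> \oo] --> (0 : R).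
  rewrite -[X in _ --> X](mulr0 (3 * c)); apply: cvgM; first exact: cvg_cst.
  exact: cvg_harmonic.
have [K _ hK] : \forall k \near \oo,
    `|s (k.+1 ^ 2)%N / (k.+1 ^ 2)%:R| < e / 2 /\ 3 * c * k.+1%:R^-1 < e / 2.
  near=> k; split.
    rewrite -[X in `|X|]subr0 distrC.
    by near: k; move/cvgrPdist_lt : sq; apply.
  apply: le_lt_trans (ler_norm _) _; rewrite -[X in `|X|]subr0 distrC.
  by near: k; move/cvgrPdist_lt : hc; apply.
near=> n.
have nK : (K.+1 ^ 2 <= n)%N by near: n; exact: nbhs_infty_ge.
have n0 : (0 < n)%N by apply: leq_trans nK; rewrite expn_gt0.
have [k /andP[kn nk]] := square_bracket n0.
have Kk : (K <= k)%N.
  have : (K.+1 ^ 2 < k.+2 ^ 2)%N by exact: leq_ltn_trans nK nk.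
  by rewrite ltn_exp2r// !ltnS.
have [h1 h2] := hK k Kk.
rewrite sub0r normrN normrM ger0_norm ?invr_ge0// mulrC.
have n0R : 0 < n%:R :> R by rewrite ltr0n.
have k0R : 0 < (k.+1 ^ 2)%:R :> R by rewrite ltr0n expn_gt0.
apply: (@le_lt_trans _ _ ((`|s (k.+1 ^ 2)%N| + (n - k.+1 ^ 2)%:R * c) / n%:R)).
  rewrite ler_pM2r ?invr_gt0//.
  have := sD (k.+1 ^ 2)%N (n - k.+1 ^ 2)%N; rewrite subnKC// => h.
  by rewrite -[s n](subrK (s (k.+1 ^ 2)%N)) addrC (le_trans (ler_normD _ _))// lerD.
rewrite mulrDl [e]splitr ltrD//.
  apply: le_lt_trans h1; rewrite normrM (gtr0_norm (x := _^-1)) ?invr_gt0//.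
  by rewrite ler_wpM2l// lef_pV2// ler_nat.
apply: le_lt_trans h2; rewrite ler_pdivrMr//.
apply: (@le_trans _ _ (3 * c * k.+1%:R^-1 * (k.+1 ^ 2)%:R)); last first.
  by rewrite ler_wpM2l ?ler_nat// !mulr_ge0.
rewrite natrX expr2 mulrA mulfVK ?pnatr_eq0//.
have : ((n - k.+1 ^ 2)%:R : R) <= 3 * k.+1%:R.
  rewrite -natrM ler_nat leq_subLR; apply: (leq_trans (ltnW nk)).
  by rewrite -!mulnn; lia.
move=> h; apply: (le_trans (ler_wpM2r c0 h)).
by rewrite mulrAC.
Unshelve. all: by end_near. Qed.

End SquareSubsequence.

Section StrongLaw.
Context d (Omega : measurableType d) (R : realType) (P : probability Omega R).

(** Telescoping: 1/x^2 <= 2/(x(x+1)) = 2/x - 2/(x+1) for x >= 1. The subtracted term is what makes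
    the induction close. *)
Lemma sum_inv_square_le2 m : \sum_(k < m) ((k.+1 ^ 2)%:R^-1 : R) <= 2 - 2 / m.+1%:R.
Proof.
elim: m => [|m IH]; first by rewrite big_ord0 divr1 subrr.
rewrite big_ord_recr/=.
have h : (m.+1 ^ 2)%:R^-1 <= 2 / m.+1%:R - 2 / m.+2%:R :> R.
  rewrite natrX -[m.+2%:R]natr1; have : 1 <= m.+1%:R :> R by rewrite ler1n.
  move: (m.+1%:R : R) => x x1; have x0 : 0 < x by rewrite (lt_le_trans ltr01).
  have -> : 2 / x - 2 / (x + 1) = 2 / (x * (x + 1)).
    by field; rewrite !gt_eqF// addr_gt0.
  rewrite ler_pdivlMr ?mulr_gt0 ?addr_gt0// expr2 invfM.
  have -> : x^-1 * x^-1 * (x * (x + 1)) = 1 + x^-1 by field; rewrite gt_eqF.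
  by have := invf_le1 x0; rewrite x1 => h; lra.
by apply: (le_trans (lerD IH h)); rewrite addrA subrK.
Qed.

Variables (D : nat -> Omega -> R) (c : R).
Hypothesis mD : forall k, measurable_fun setT (D k).
Hypothesis Dc : forall k w, `|D k w| <= c.
Let S n w : R := \sum_(l < n) D l w.
Hypothesis orthoD : forall n, \int[P]_w (S n w * D n w) = 0.

Let bD k : bounded_rv (D k). Proof. by split=> //; exists c. Qed.

Let bS n : bounded_rv (S n). Proof. exact: bounded_rv_sum. Qed.

(** When the square is expanded, the cross term vanishes by [orthoD] and the last one is at most
    c^2. *)
Let second_moment n : \int[P]_w (S n w * S n w) <= n%:R * c ^+ 2.
Proof.
elim: n => [|n IH].
  under eq_Rintegral do rewrite /S big_ord0 mul0r.
  by rewrite Rintegral_prob_cst mul0r.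
have -> : \int[P]_w (S n.+1 w * S n.+1 w) =
    \int[P]_w (S n w * S n w + (2 * (S n w * D n w) + D n w * D n w)).
  by apply: eq_Rintegral => w _; rewrite /S big_ord_recr/=; ring.
rewrite !Rintegral_bdD ?Rintegral_bdZ ?orthoD ?mulr0 ?add0r;
  try by repeat (apply: bounded_rvD || apply: bounded_rvM ||
    exact: bounded_rv_cst || exact: bS || exact: bD).
rewrite -natr1 mulrDl mul1r lerD// -[leRHS](Rintegral_prob_cst P).
apply: le_Rintegral_bd; [by apply: bounded_rvM; exact: bD|exact: bounded_rv_cst|].
move=> w; rewrite -expr2 -[D n w ^+ 2]ger0_norm ?sqr_ge0// normrX.
by rewrite lerXn2r// nnegrE// (le_trans _ (Dc n w)).
Qed.

(** The squared average at time (k+1)^2 has mean at most c^2/(k+1)^2, which is summable. The series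
    of these squares is thus almost surely finite, its terms tend to 0, and [mean_cvg0_of_squares]
    covers the times in between. *)
Lemma strong_law_orthogonal :
  {ae P, forall w, n%:R^-1 * (\sum_(l < n) D l w) @[n --> \oo] --> (0 : R)}.
Proof.
pose Z k w : R := (S (k.+1 ^ 2)%N w / (k.+1 ^ 2)%:R) ^+ 2.
have bZ k : bounded_rv (Z k).
  rewrite /Z; under eq_fun do rewrite expr2.
  have hb := bounded_rvM (bS (k.+1 ^ 2)) (bounded_rv_cst Omega (k.+1 ^ 2)%:R^-1).
  exact: (bounded_rvM hb hb).
have Z0 k w : 0 <= Z k w by exact: sqr_ge0.
have IZ k : \int[P]_w Z k w <= c ^+ 2 * (k.+1 ^ 2)%:R^-1.
  have -> : \int[P]_w Z k w = (k.+1 ^ 2)%:R^-1 ^+ 2 *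
      \int[P]_w (S (k.+1 ^ 2)%N w * S (k.+1 ^ 2)%N w).
    rewrite -Rintegral_bdZ; last by apply: bounded_rvM; exact: bS.
    by apply: eq_Rintegral => w _; rewrite /Z exprMn mulrC expr2 [X in _ * X]expr2.
  apply: (le_trans (ler_wpM2l _ (second_moment _))); first exact: sqr_ge0.
  have : (k.+1 ^ 2)%:R != 0 :> R by rewrite pnatr_eq0 expn_eq0.
  move: (_%:R : R) => x x0.
  by have -> : x^-1 ^+ 2 * (x * c ^+ 2) = c ^+ 2 / x by field.
have mZ k : measurable_fun setT (EFin \o Z k) by apply/measurable_EFinP; case: (bZ k).
have iZ : P.-integrable setT (fun w => \sum_(0 <= k <oo) (Z k w)%:E)%E.
  apply/integrableP; split.
    apply: (ge0_emeasurable_sum (h := fun k w => (Z k w)%:E) (P := xpredT)).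
      by move=> k w _ _; rewrite lee_fin.
    by move=> k _; exact: mZ.
  apply: (@le_lt_trans _ _ (c ^+ 2 * 2)%:E); last exact: ltry.
  rewrite (eq_integral (fun w => \sum_(0 <= k <oo) (Z k w)%:E)%E); last first.
    by move=> w _; rewrite gee0_abs// nneseries_ge0// => k _ _; rewrite lee_fin.
  rewrite integral_nneseries//; last by move=> k w _; rewrite lee_fin.
  apply: lime_le.
    apply: is_cvg_nneseries => k _ _.
    by apply: integral_ge0 => w _; rewrite lee_fin.
  apply: nearW => m; rewrite big_mkord.
  under eq_bigr do rewrite integral_bounded_rv//.
  rewrite sumEFin lee_fin.
  apply: (@le_trans _ _ (\sum_(k < m) (c ^+ 2 * (k.+1 ^ 2)%:R^-1))).
    by apply: ler_sum => k _; exact: IZ.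
  rewrite -mulr_sumr ler_wpM2l ?sqr_ge0// (le_trans (sum_inv_square_le2 m))//.
  by rewrite gerDl oppr_le0 divr_ge0.
have := integrable_ae measurableT iZ.
apply: filterS => w /= /(_ Logic.I) Zfin.
apply: (@mean_cvg0_of_squares _ (S ^~ w) c) => [n|].
  by rewrite /S big_ord_recr/= addrAC subrr add0r.
have Zw : Z k w @[k --> \oo] --> (0 : R).
  apply: cvg_series_cvg_0; apply: nondecreasing_is_cvgn.
    by apply: nondecreasing_series => k _ _; exact: Z0.
  exists (fine (\sum_(0 <= k <oo) (Z k w)%:E)%E) => _ [m _ <-].
  rewrite -lee_fin fineK// /series/= -sumEFin.
  by apply: nneseries_lim_ge => k _ _; rewrite lee_fin.
have : Num.sqrt (Z k w) @[k --> \oo] --> Num.sqrt (0 : R).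
  by apply: continuous_cvg Zw; exact: sqrt_continuous.
rewrite sqrtr0; under eq_fun do rewrite sqrtr_sqr.
by move=> /norm_cvg0P.
Qed.

End StrongLaw.

(** * The mean dynamics *)

Section MatrixLimits.
Context {R : realType}.

Lemma cvg_mxP T (F : set_system T) {FF : Filter F} m n (u : T -> 'M[R]_(m, n)) (l : 'M[R]_(m, n)) :
  u x @[x --> F] --> l <-> forall i j, u x i j @[x --> F] --> l i j.
Proof.
split=> [ul i j|ul].
  apply: (@cvg_comp _ _ _ u (fun A : 'M[R]_(m, n) => A i j) F _ _ ul).
  exact: coord_continuous.
apply/cvgrPdist_lt => e e0.
have : \forall x \near F, forall ij : 'I_m * 'I_n, `|l ij.1 ij.2 - u x ij.1 ij.2| < e.
  apply: filter_forall => -[i j] /=.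
  by have /cvgrPdist_lt := ul i j; apply.
apply: filterS => x h; rewrite /Num.norm/= mx_normrE.
by apply/bigmax_ltP; split=> // ij _; rewrite !mxE.
Qed.

Lemma mx_norm_le m n (A : 'M[R]_(m, n)) c : 0 <= c ->
  (forall i j, `|A i j| <= c) -> `|A| <= c.
Proof.
move=> c0 Ac; rewrite /Num.norm/= mx_normrE.
by apply/bigmax_leP; split=> // ij _.
Qed.

Lemma le_mx_norm m n (A : 'M[R]_(m, n)) i j : `|A i j| <= `|A|.
Proof.
rewrite [leRHS]/Num.norm/= mx_normrE.
exact: (le_bigmax_cond 0 (fun ij : 'I_m * 'I_n => `|A ij.1 ij.2|) (j := (i, j)) (P := xpredT)).
Qed.

Lemma cvg_sumr T (F : set_system T) {FF : Filter F} (I : Type) (r : seq I)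
    (f : I -> T -> R) (l : I -> R) :
  (forall i, f i x @[x --> F] --> l i) ->
  \sum_(i <- r) f i x @[x --> F] --> \sum_(i <- r) l i.
Proof.
move=> fl; elim: r => [|i r IH].
  by rewrite big_nil; under eq_fun do rewrite big_nil; exact: cvg_cst.
by rewrite big_cons; under eq_fun do rewrite big_cons; exact: cvgD.
Qed.

Lemma cvg_mulmxl T (F : set_system T) {FF : Filter F} m n p (A : 'M[R]_(m, n))
    (u : T -> 'M[R]_(n, p)) (l : 'M[R]_(n, p)) :
  u x @[x --> F] --> l -> A *m u x @[x --> F] --> A *m l.
Proof.
move=> /cvg_mxP ul; apply/cvg_mxP => i j; rewrite mxE.
under eq_fun do rewrite mxE.
by apply: cvg_sumr => k; apply: cvgM; [exact: cvg_cst|exact: ul].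
Qed.

End MatrixLimits.

Section Dynamics.
Context {R : realType} {n : nat}.
Implicit Types (M W : 'M[R]_n) (y e : 'cV[R]_n) (lam : 'rV[R]_n).

Lemma opinion_stepE lam M y e v : opinion_step lam M y e v 0 =
  lam 0 v * (\sum_j M v j * y j 0) + (1 - lam 0 v) * e v 0.
Proof.
rewrite /opinion_step mxE -mulmxA mul_diag_mx mxE.
by rewrite mulmxBl mul1mx mul_diag_mx !mxE mulrBl mul1r.
Qed.

Lemma row_stochasticP M : row_stochastic M <->
  (forall v w, 0 <= M v w) /\ forall v, \sum_j M v j = 1.
Proof.
rewrite /row_stochastic; split=> -[M0 M1]; split=> //.
  move=> v; have /matrixP/(_ v 0) := M1; rewrite !mxE => <-.
  by apply: eq_bigr => j _; rewrite mxE mulr1.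
apply/matrixP => v j; rewrite !mxE -[RHS](M1 v).
by apply: eq_bigr => i _; rewrite mxE mulr1.
Qed.

Lemma row_stochastic1 : row_stochastic (1%:M : 'M[R]_n).
Proof.
split; first by move=> v w; rewrite mxE ler0n.
by rewrite mul1mx.
Qed.

Lemma stochastic_row_le M y c v : row_stochastic M -> (forall j, y j 0 <= c) ->
  \sum_j M v j * y j 0 <= c.
Proof.
move=> /row_stochasticP[M0 M1] yc; rewrite -[leRHS]mul1r -(M1 v) mulr_suml.
by apply: ler_sum => j _; rewrite ler_wpM2l.
Qed.

Lemma opinion_step_ge0 lam M y e : (forall v, 0 <= lam 0 v <= 1) ->
  row_stochastic M -> (forall v, 0 <= y v 0) -> (forall v, 0 <= e v 0) ->
  forall v, 0 <= opinion_step lam M y e v 0.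
Proof.
move=> lam01 [M0 _] y0 e0 v; have /andP[l0 l1] := lam01 v.
rewrite opinion_stepE addr_ge0 ?mulr_ge0 ?subr_ge0//.
by apply: sumr_ge0 => j _; rewrite mulr_ge0.
Qed.

Lemma opinion_step_cube lam M y e : (forall v, 0 <= lam 0 v <= 1) ->
  row_stochastic M -> in_unit_cube y -> in_unit_cube e ->
  in_unit_cube (opinion_step lam M y e).
Proof.
move=> lam01 sM y01 e01 v; have /andP[l0 l1] := lam01 v.
apply/andP; split.
  by apply: opinion_step_ge0 => // w; [case/andP: (y01 w)|case/andP: (e01 w)].
rewrite opinion_stepE.
have /(ler_wpM2l l0) hy : \sum_j M v j * y j 0 <= 1.
  by apply: stochastic_row_le => // j; case/andP: (y01 j).
have l10 : 0 <= 1 - lam 0 v by rewrite subr_ge0.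
have /(ler_wpM2l l10) he : e v 0 <= 1 by case/andP: (e01 v).
by move: hy he; lra.
Qed.

Lemma opinion_stepB lam M y y' e : opinion_step lam M y e - opinion_step lam M y' e =
  opinion_step lam M (y - y') 0.
Proof. by rewrite /opinion_step mulmx0 addr0 mulmxBr opprD addrACA subrr addr0. Qed.

Lemma opinion_step_monotone lam M y y' e : (forall v, 0 <= lam 0 v <= 1) ->
  row_stochastic M -> (forall v, y v 0 <= y' v 0) ->
  forall v, opinion_step lam M y e v 0 <= opinion_step lam M y' e v 0.
Proof.
move=> lam01 sM yy' v.
have := @opinion_step_ge0 lam M (y' - y) 0 lam01 sM.
rewrite -(opinion_stepB _ _ _ _ e) => /(_ _ _ v); rewrite !mxE subr_ge0; apply.
  by move=> w; rewrite !mxE subr_ge0.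
by move=> w; rewrite mxE.
Qed.

End Dynamics.

Section MeanMatrix.
Context {R : realType} {n : nat}.
Variables (W : 'M[R]_n) (lam : 'rV[R]_n) (alpha : R).
Hypothesis W_stoch : row_stochastic W.
Hypothesis lam01 : forall v, 0 <= lam 0 v <= 1.
Hypothesis alpha01 : 0 <= alpha <= 1.
Hypothesis alpha0 : alpha = 0 -> forall v, lam 0 v < 1.
Hypothesis topologyA : topology_assumption W lam.

Definition mean_influence : 'M[R]_n := (1 - alpha) *: 1%:M + alpha *: W.
Local Notation Wbar := mean_influence.

Lemma mean_influence_stoch : row_stochastic Wbar.
Proof.
have /andP[a0 a1] := alpha01; have [W0 W1] := W_stoch.
split=> [v w|].
  by rewrite !mxE addr_ge0 ?mulr_ge0 ?subr_ge0 ?ler0n.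
by rewrite mulmxDl -!scalemxAl mul1mx W1 -scalerDl subrK scale1r.
Qed.

Lemma mean_influence_edge v w : 0 < alpha -> 0 < W v w -> 0 < Wbar v w.
Proof.
have /andP[_ a1] := alpha01; move=> a0 W0.
by rewrite !mxE ltr_wpDl ?mulr_gt0// mulr_ge0 ?subr_ge0 ?ler0n.
Qed.

Lemma mean_fixpoint0 (h : 'cV[R]_n) : diag_mx lam *m Wbar *m h = h -> h = 0.
Proof.
move=> hE; apply/eqP/contraT => h0.
have [i0 hi0] : exists i, h i 0 != 0.
  apply/existsP; apply: contraNT h0 => /existsPn h0; apply/eqP/matrixP => i j.
  by rewrite !mxE ord1; apply/eqP; rewrite -[_ == _]negbK; exact: h0.
have [i M_max] : exists i, forall j, `|h j 0| <= `|h i 0|.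
  exists [arg max_(i > i0) `|h i 0|]%O.
  by case: arg_maxP => // i _ hi j; exact: hi.
have [Wbar0 Wbar1] := (row_stochasticP Wbar).1 mean_influence_stoch.
pose c := `|h i 0|.
have c0 : 0 < c by rewrite (lt_le_trans _ (M_max i0))// normr_gt0.
have hv v : h v 0 = lam 0 v * \sum_j Wbar v j * h j 0.
  by rewrite -{1}hE -mulmxA mul_diag_mx !mxE.
(* Where [|h|] is maximal, [lam] is 1 and [|h|] is maximal at every neighbour. *)
have key v : `|h v 0| = c ->
    lam 0 v = 1 /\ (0 < alpha -> forall j, 0 < W v j -> `|h j 0| = c).
  move=> hvc; have /andP[l0 l1] := lam01 v.
  have sum_le : \sum_j Wbar v j * `|h j 0| <= c.
    rewrite -[leRHS]mul1r -(Wbar1 v) mulr_suml.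
    by apply: ler_sum => j _; rewrite ler_wpM2l.
  have c_le : c <= lam 0 v * \sum_j Wbar v j * `|h j 0|.
    rewrite -hvc {1}hv normrM ger0_norm// ler_wpM2l//.
    rewrite (le_trans (ler_norm_sum _ _ _))// ler_sum// => j _.
    by rewrite normrM ger0_norm.
  have lam1 : lam 0 v = 1.
    apply/eqP; rewrite eq_le l1/= -(ler_pM2r c0) mul1r.
    by apply: (le_trans c_le); rewrite ler_wpM2l.
  split=> // a0 j Wvj.
  (* A weighted mean of numbers at most [c] equals [c] only if every term of positive weight
     does. *)
  have sum0 : \sum_j Wbar v j * (c - `|h j 0|) = 0.
    under eq_bigr do rewrite mulrBr; rewrite sumrB -mulr_suml Wbar1 mul1r.
    apply/eqP; rewrite subr_eq0 eq_le sum_le andbT.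
    by move: c_le; rewrite lam1 mul1r.
  have term0 k : 0 <= Wbar v k * (c - `|h k 0|) by rewrite mulr_ge0// subr_ge0.
  have /(_ j isT)/eqP := psumr_eq0P (fun k _ => term0 k) sum0.
  rewrite mulf_eq0 gt_eqF ?mean_influence_edge//= subr_eq0 => /eqP.
  by move=> ->.
(* For [alpha = 0] the mean matrix is the identity and the maximum does not travel along edges, but
   [alpha0] already excludes [lam 0 i = 1]. *)
have [a0|a0] := eqVneq alpha 0.
  by have := alpha0 a0 i; rewrite (key i _).1// ltxx.
have {}a0 : 0 < alpha by rewrite lt_neqAle eq_sym a0; case/andP: alpha01.
have [s /connectP[p pp ->]] := topologyA i.
suff last_max : forall j, `|h j 0| = c -> path (influence_edge W) j p ->
    lam 0 (last j p) = 1 by rewrite last_max// ltxx.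
elim: p {pp} => [|k p IH] j hj /=; first by move=> _; case: (key j hj).
move=> /andP[jk kp]; apply: IH => //.
by have [_] := key j hj; apply.
Qed.

(** The kernel is trivial by [mean_fixpoint0]; the transpose appears because [row_free] concerns
    multiplication on the left. *)
Lemma unitmx_mean : 1%:M - diag_mx lam *m Wbar \in unitmx.
Proof.
rewrite -unitmx_tr -row_free_unit; apply: inj_row_free => v.
move=> hv.
have : (1%:M - diag_mx lam *m Wbar) *m v^T = 0.
  by rewrite -[X in X *m _]trmxK -trmx_mul hv trmx0.
rewrite mulmxBl mul1mx => /subr0_eq/esym/mean_fixpoint0 v0.
by rewrite -[v]trmxK v0 trmx0.
Qed.

(** The first iterate stays in the unit cube, hence below the all-ones vector; by monotonicity the
    whole sequence decreases entrywise. Its limit is a fixed vector, so it is 0. *)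
Lemma mean_iter_cvg0 (r : nat -> 'cV[R]_n) : r 0%N = const_mx 1 ->
  (forall k, r k.+1 = diag_mx lam *m Wbar *m r k) ->
  r k @[k --> \oo] --> (0 : 'cV[R]_n).
Proof.
move=> r0 rS; have sWbar := mean_influence_stoch.
have rE k : r k.+1 = opinion_step lam Wbar (r k) 0.
  by rewrite rS /opinion_step mulmx0 addr0.
have r_ge0 k v : 0 <= r k v 0.
  elim: k v => [|k IH] v; first by rewrite r0 mxE.
  by rewrite rE; apply: opinion_step_ge0 => // w; rewrite mxE.
have r_nd k v : r k.+1 v 0 <= r k v 0.
  elim: k v => [|k IH] v; last first.
    by rewrite (rE k.+1) {2}(rE k); exact: opinion_step_monotone.
  have : in_unit_cube (r 1%N).
    rewrite rE r0; apply: opinion_step_cube => // w; rewrite mxE ?lexx ?ler01//.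
  by move=> /(_ v) /andP[_]; rewrite r0 mxE.
have cr v : r k v 0 @[k --> \oo] --> limn (fun k => r k v 0).
  apply: nonincreasing_is_cvgn; first by apply/nonincreasing_seqP => k.
  by exists 0 => _ [k _ <-].
pose h : 'cV[R]_n := \col_v limn (fun k => r k v 0).
have rh : r k @[k --> \oo] --> h.
  by apply/cvg_mxP => v j; rewrite ord1 mxE; exact: cr.
rewrite -(@mean_fixpoint0 h)//; have rSh : r k.+1 @[k --> \oo] --> h by rewrite (cvg_shiftS r).
have : diag_mx lam *m Wbar *m r k @[k --> \oo] --> diag_mx lam *m Wbar *m h.
  exact: cvg_mulmxl.
under eq_fun do rewrite -rS.
by move=> /norm_cvg_unique; apply.
Qed.

End MeanMatrix.

(** * Forward and backward compositions *)

Section Paths.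
Context {R : realType} {n : nat}.
Variables (W : 'M[R]_n) (lam : 'rV[R]_n).
Hypothesis W_stoch : row_stochastic W.
Hypothesis lam01 : forall v, 0 <= lam 0 v <= 1.

(* Equals [M] almost surely when [M] is drawn from the influence law, and is
   stochastic surely. *)
Definition actual_influence (M : 'M[R]_n) : 'M[R]_n := if M == W then W else 1%:M.

Definition random_step (z : 'M[R]_n * 'cV[R]_n) (y : 'cV[R]_n) : 'cV[R]_n :=
  opinion_step lam (actual_influence z.1) y z.2.

Fixpoint forward (p : nat -> 'M[R]_n * 'cV[R]_n) (k : nat) (y : 'cV[R]_n) : 'cV[R]_n :=
  if k is k'.+1 then random_step (p k') (forward p k' y) else y.

(** Draw [s] is applied last and draw [s + k - 1] first, so that raising [k] changes only the
    innermost argument. *)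
Fixpoint backward (p : nat -> 'M[R]_n * 'cV[R]_n) (k s : nat) (y : 'cV[R]_n) : 'cV[R]_n :=
  if k is k'.+1 then random_step (p s) (backward p k' s.+1 y) else y.

Implicit Types (y : 'cV[R]_n) (p q : nat -> 'M[R]_n * 'cV[R]_n).

Lemma actual_influence_stoch M : row_stochastic (actual_influence M).
Proof. by rewrite /actual_influence; case: ifP => _ //; exact: row_stochastic1. Qed.

Lemma measurable_actual_influence : measurable_fun setT actual_influence.
Proof.
apply: measurable_fun_ifT => //.
apply: (@measurable_fun_bool _ _ _ _ true); rewrite setTI.
rewrite (_ : _ @^-1` _ = [set W]); first exact: measurable_mx_set1.
by apply/seteqP; split=> M /= /eqP.
Qed.

Lemma measurable_step d (T : measurableType d) (p : T -> 'M[R]_n * 'cV[R]_n)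
    (y : T -> 'cV[R]_n) :
  measurable_fun setT p -> measurable_fun setT y ->
  measurable_fun setT (fun t => random_step (p t) (y t)).
Proof.
move=> mp my; rewrite /random_step /opinion_step.
apply: measurable_addmx.
  apply: measurable_mulmx => //; apply: measurable_mulmx => //.
  apply: measurableT_comp; first exact: measurable_actual_influence.
  exact: measurableT_comp measurable_fst mp.
by apply: measurable_mulmx => //; exact: measurableT_comp measurable_snd mp.
Qed.

Lemma measurable_forward d (T : measurableType d) (p : nat -> T -> 'M[R]_n * 'cV[R]_n)
    k (y : T -> 'cV[R]_n) :
  (forall j, (j < k)%N -> measurable_fun setT (p j)) -> measurable_fun setT y ->
  measurable_fun setT (fun t => forward (p ^~ t) k (y t)).
Proof.
elim: k => //= k IH mp my; apply: measurable_step; first exact: mp.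
by apply: IH => // j jk; apply: mp; rewrite ltnW.
Qed.

Lemma measurable_backward d (T : measurableType d) (p : nat -> T -> 'M[R]_n * 'cV[R]_n)
    k s (y : T -> 'cV[R]_n) :
  (forall j, (s <= j)%N -> measurable_fun setT (p j)) -> measurable_fun setT y ->
  measurable_fun setT (fun t => backward (p ^~ t) k s (y t)).
Proof.
elim: k s => //= k IH s mp my; apply: measurable_step; first exact: mp.
by apply: IH => // j sj; apply: mp; rewrite ltnW.
Qed.

Lemma forward_cube p k y : (forall j, in_unit_cube (p j).2) -> in_unit_cube y ->
  in_unit_cube (forward p k y).
Proof.
by move=> pc yc; elim: k => //= k IH; apply: opinion_step_cube => //; exact: actual_influence_stoch.
Qed.

Lemma backward_cube p k s y : (forall j, in_unit_cube (p j).2) -> in_unit_cube y ->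
  in_unit_cube (backward p k s y).
Proof.
move=> pc yc; elim: k s => //= k IH s.
by apply: opinion_step_cube => //; exact: actual_influence_stoch.
Qed.

Lemma zero_cube : in_unit_cube (0 : 'cV[R]_n).
Proof. by move=> v; rewrite mxE lexx ler01. Qed.

(** Common inputs cancel and the matrices are nonnegative, so the absolute differences are dominated
    by the input-free recursion started from the constant vector [c]. *)
Lemma forwardB p k y (y' : 'cV[R]_n) (c : R) : (forall v, `|y v 0 - y' v 0| <= c) ->
  forall v, `|forward p k y v 0 - forward p k y' v 0| <=
    c * forward (fun j => ((p j).1, 0)) k (const_mx 1) v 0.
Proof.
move=> yc; elim: k => [|k IH] v /=; first by rewrite mxE mulr1.
have [A0 A1] := actual_influence_stoch (p k).1.
have /andP[l0 l1] := lam01 v.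
rewrite /random_step !opinion_stepE opprD addrACA subrr addr0 -mulrBr -sumrB.
rewrite mxE mulr0 addr0 normrM ger0_norm// mulrCA ler_wpM2l// mulr_sumr.
rewrite (le_trans (ler_norm_sum _ _ _))// ler_sum// => j _.
by rewrite -mulrBr normrM ger0_norm// mulrCA ler_wpM2l.
Qed.

Lemma forward0_norm_nonincreasing q k y : (forall j, (q j).2 = 0) ->
  `|forward q k.+1 y| <= `|forward q k y|.
Proof.
move=> q0; apply: mx_norm_le => // v j; rewrite ord1 /= /random_step opinion_stepE q0.
rewrite mxE mulr0 addr0.
have /row_stochasticP[A0 A1] := actual_influence_stoch (q k).1.
have /andP[l0 l1] := lam01 v.
rewrite normrM ger0_norm// -[leRHS]mul1r ler_pM//.
rewrite (le_trans (ler_norm_sum _ _ _))// -[leRHS]mul1r -(A1 v) mulr_suml.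
by apply: ler_sum => i _; rewrite normrM ger0_norm// ler_wpM2l// le_mx_norm.
Qed.

(** One more draw replaces the innermost 0 by a nonnegative vector, and every step is monotone. *)
Lemma backward_nondecreasing p k s v : (forall j, in_unit_cube (p j).2) ->
  backward p k s 0 v 0 <= backward p k.+1 s 0 v 0.
Proof.
move=> pc; elim: k s v => [|k IH] s v.
  rewrite /= mxE; apply: opinion_step_ge0 => //; first exact: actual_influence_stoch.
  - by move=> w; rewrite mxE.
  - by move=> w; case/andP: (pc s w).
by apply: opinion_step_monotone => //; exact: actual_influence_stoch.
Qed.

Definition backward_limit p s : 'cV[R]_n := \col_v limn (fun k => backward p k s 0 v 0).

Lemma backward_cvg p s : (forall j, in_unit_cube (p j).2) ->
  backward p k s 0 @[k --> \oo] --> backward_limit p s.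
Proof.
move=> pc; apply/cvg_mxP => v j; rewrite ord1 mxE.
apply: nondecreasing_is_cvgn.
  by apply/nondecreasing_seqP => k; exact: backward_nondecreasing.
exists 1 => _ [k _ <-].
by have /(_ v)/andP[] := @backward_cube p k s 0 pc zero_cube.
Qed.

Lemma backward_limit_cube p s : (forall j, in_unit_cube (p j).2) ->
  in_unit_cube (backward_limit p s).
Proof.
move=> pc v; have /cvg_mxP/(_ v 0) h := @backward_cvg p s pc.
have bc k := @backward_cube p k s 0 pc zero_cube v.
rewrite -(cvg_lim _ h)//; apply/andP; split.
  by apply: limr_ge; [apply/cvg_ex; eexists; exact: h|apply: nearW => k; case/andP: (bc k)].
by apply: limr_le; [apply/cvg_ex; eexists; exact: h|apply: nearW => k; case/andP: (bc k)].
Qed.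

(** The recursion defining [backward] passes to the limit by continuity of a single affine step. *)
Lemma backward_limit_step p s : (forall j, in_unit_cube (p j).2) ->
  backward_limit p s = random_step (p s) (backward_limit p s.+1).
Proof.
move=> pc.
have h1 : backward p k.+1 s 0 @[k --> \oo] --> backward_limit p s.
  by have := @backward_cvg p s pc; rewrite -(cvg_shiftS (fun k => backward p k s 0)).
have h2 : backward p k.+1 s 0 @[k --> \oo] --> random_step (p s) (backward_limit p s.+1).
  rewrite /= /random_step /opinion_step; apply: cvgD; last exact: cvg_cst.
  by apply: cvg_mulmxl; exact: backward_cvg.
exact: (norm_cvg_unique h1 h2).
Qed.

Lemma measurable_backward_limit d (T : measurableType d)
    (p : nat -> T -> 'M[R]_n * 'cV[R]_n) s :
  (forall j t, in_unit_cube (p j t).2) ->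
  (forall j, (s <= j)%N -> measurable_fun setT (p j)) ->
  measurable_fun setT (fun t => backward_limit (p ^~ t) s).
Proof.
move=> pc mp; apply: measurable_mx => v j; rewrite ord1.
apply: (measurable_fun_cvg (h := fun k t => backward (p ^~ t) k s 0 v 0)).
  by move=> k; apply: measurable_mx_coord; apply: measurable_backward.
move=> t _; have /cvg_mxP/(_ v 0) := @backward_cvg (p ^~ t) s (pc ^~ t).
by apply.
Qed.

End Paths.

(** * Time averages of affine recursions *)

Section CesaroMeans.
Context {R : realType} {n : nat}.

Lemma cesaro_vector (u : nat -> 'cV[R]_n) (l : 'cV[R]_n) :
  u k @[k --> \oo] --> l ->
  t%:R^-1 *: (\sum_(k < t) u k) @[t --> \oo] --> l.
Proof.
move=> /cvg_mxP ul; apply/cvg_mxP => i j.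
have := cesaro (ul i j); rewrite /arithmetic_mean => hc.
rewrite -(cvg_shiftS (fun t => (t%:R^-1 *: (\sum_(k < t) u k)) i j)).
under eq_fun do rewrite mxE summxE -(big_mkord xpredT (fun k => u k i j)).
exact: hc.
Qed.

(** Summing the recursion gives (I - A) times the sum of [z] as t b, plus the sum of [e], plus the
    boundary term z(0) - z(t). After division by t the last two vanish. *)
Lemma affine_recursion_mean (A : 'M[R]_n) (b : 'cV[R]_n) (z e : nat -> 'cV[R]_n) (c : R) :
  1%:M - A \in unitmx ->
  (forall k, z k.+1 = A *m z k + b + e k) ->
  (forall k, `|z k| <= c) ->
  t%:R^-1 *: (\sum_(k < t) e k) @[t --> \oo] --> (0 : 'cV[R]_n) ->
  t%:R^-1 *: (\sum_(k < t) z k) @[t --> \oo] --> invmx (1%:M - A) *m b.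
Proof.
move=> uA zS zc e0.
have sumE t : (1%:M - A) *m (\sum_(k < t) z k) =
    t%:R *: b + \sum_(k < t) e k + (z 0%N - z t).
  elim: t => [|t IH]; first by rewrite !big_ord0 mulmx0 scale0r subrr !addr0.
  rewrite !big_ord_recr/= mulmxDr IH zS -natr1 scalerDl scale1r mulmxBl mul1mx.
  apply/matrixP => i j; rewrite !mxE; ring.
have zt0 : t%:R^-1 *: (z 0%N - z t) @[t --> \oo] --> (0 : 'cV[R]_n).
  apply/norm_cvg0P.
  have h2c : t.+1%:R^-1 * (c + c) @[t --> \oo] --> (0 : R).
    rewrite -[X in _ --> X](mul0r (c + c)); apply: cvgM; last exact: cvg_cst.
    exact: cvg_harmonic.
  rewrite -(cvg_shiftS (fun t => `|t%:R^-1 *: (z 0%N - z t)|)).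
  apply: squeeze_cvgr (cvg_cst 0) h2c; apply: nearW => t.
  rewrite normr_ge0/= normrZ ger0_norm ?invr_ge0// ler_wpM2l ?invr_ge0//.
  by rewrite (le_trans (ler_normB _ _))// lerD.
(* At [t = 0] the coefficient is 0, so the equality with [b] holds only eventually. *)
have bt : (t%:R^-1 * t%:R) *: b @[t --> \oo] --> b.
  apply: cvg_near_cst; near=> t.
  have t0 : (0 < t)%N by near: t; exact: nbhs_infty_gt.
  by rewrite mulVf ?scale1r// pnatr_eq0 -lt0n.
have lim1 : (1%:M - A) *m (t%:R^-1 *: (\sum_(k < t) z k)) @[t --> \oo] --> b.
  rewrite -[X in _ --> X]addr0 -[X in _ --> X]addr0.
  have -> : (fun t => (1%:M - A) *m (t%:R^-1 *: (\sum_(k < t) z k))) =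
      (fun t => (t%:R^-1 * t%:R) *: b + t%:R^-1 *: (\sum_(k < t) e k) +
                t%:R^-1 *: (z 0%N - z t)).
    by apply/funext => t; rewrite -scalemxAr sumE !scalerDr scalerA.
  by apply: cvgD => //; exact: cvgD.
have : invmx (1%:M - A) *m ((1%:M - A) *m (t%:R^-1 *: (\sum_(k < t) z k))) @[t --> \oo] -->
    invmx (1%:M - A) *m b by exact: cvg_mulmxl.
by under eq_fun do rewrite mulKmx//.
Unshelve. all: by end_near. Qed.

End CesaroMeans.

(** * The random affine recursion *)

Section Model.
Context d (Omega : measurableType d) (R : realType) (P : probability Omega R).
Context (n : nat) (W : 'M[R]_n) (lam : 'rV[R]_n) (alpha : R) (eta0 : 'cV[R]_n).
Variables (Pt : nat -> {RV P >-> 'M[R]_n}) (noise : nat -> {RV P >-> 'cV[R]_n}).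
Hypothesis W_stoch : row_stochastic W.
Hypothesis lam01 : forall v, 0 <= lam 0 v <= 1.
Hypothesis alpha01 : 0 <= alpha <= 1.
Hypothesis alpha0 : alpha = 0 -> forall v, lam 0 v < 1.
Hypothesis topologyA : topology_assumption W lam.
Hypothesis Pt_law : forall t A, measurable A ->
  distribution P (Pt t) A =
  (alpha%:E * \d_W A + (1 - alpha)%:E * \d_(1%:M : 'M[R]_n) A)%E.
Hypothesis Pt_indep : mutually_independent P (fun t => g_sigma_algebra_preimage (Pt t)).
Hypothesis noise_indep : mutually_independent P (fun t => g_sigma_algebra_preimage (noise t)).
Hypothesis Pt_noise : independent P (sigma_process Pt) (sigma_process noise).
Hypothesis noise_law : forall t A, measurable A ->
  distribution P (noise t) A = distribution P (noise 0%N) A.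
Hypothesis noise_mean0 : forall t, has_mean P (noise t) 0.
Hypothesis input_cube : forall t w, in_unit_cube (eta0 + noise t w).
Hypothesis eta0_cube : in_unit_cube eta0.

Local Notation actual := (actual_influence W).
Local Notation step := (random_step W lam).
Local Notation Wbar := (mean_influence W alpha).
(** All times other than [t] are included, later ones too: forward compositions use the earlier
    draws, backward ones the later draws. *)
Local Notation past t := (g_sigma_algebraType (other_times Pt noise t)).
Local Notation present t := (g_sigma_algebraType (at_time Pt noise t)).

Definition draw (t : nat) (w : Omega) : 'M[R]_n * 'cV[R]_n := (Pt t w, eta0 + noise t w).

Lemma measurable_draw t : measurable_fun setT (draw t).
Proof. by apply: measurable_fun_pair => //; exact: measurable_addmx. Qed.

Lemma measurable_draw_present t : measurable_fun (setT : set (present t)) (draw t).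
Proof.
apply: measurable_fun_pair; first exact: at_time_X.
by apply: measurable_addmx => //; exact: at_time_Y.
Qed.

Lemma measurable_draw_past t j : j <> t -> measurable_fun (setT : set (past t)) (draw j).
Proof.
move=> jt; apply: measurable_fun_pair; first exact: other_times_X.
by apply: measurable_addmx => //; exact: other_times_Y.
Qed.

Lemma ae_actual_influence : {ae P, forall w, forall t, actual (Pt t w) = Pt t w}.
Proof.
apply: ae_foralln => t.
pose A := [set W] `|` [set 1%:M].
have mA : measurable A by apply: measurableU; exact: measurable_mx_set1.
have PA : P (Pt t @^-1` A) = 1%E.
  rewrite -[LHS]/(distribution P (Pt t) A) Pt_law// !diracE.
  rewrite !mem_set; [|by right|by left].
  by rewrite !mule1 -EFinD addrC subrK.
have : P.-negligible (~` (Pt t @^-1` A)).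
  apply/negligibleP; first by apply: measurableC; exact: measurable_funPTI.
  transitivity (1 - P (Pt t @^-1` A))%E; last by rewrite PA subee.
  by apply: probability_setC; exact: measurable_funPTI.
apply: negligibleS => w /= h1 h2; apply: h1; rewrite /actual_influence.
by case: h2 => ->; rewrite ?eqxx//; case: eqP.
Qed.

Lemma actual_entry_bounds M v j : 0 <= actual M v j <= 1.
Proof.
have /row_stochasticP[A0 A1] := actual_influence_stoch W_stoch M.
by rewrite A0 -(A1 v) (bigD1 j)//= lerDl sumr_ge0.
Qed.

Lemma bounded_actual t v j : bounded_rv (fun w => actual (Pt t w) v j).
Proof.
split.
  apply: measurable_mx_coord; apply: measurableT_comp => //.
  exact: measurable_actual_influence.
by exists 1 => w; have /andP[a0 a1] := actual_entry_bounds (Pt t w) v j; rewrite ger0_norm.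
Qed.

(** The matrix is the identity plus [W - 1] times the indicator of [Pt t = W]. That event has
    probability [alpha] unless [W] is the identity, in which case its coefficient is zero. *)
Lemma mean_actual_influence t v j : \int[P]_w actual (Pt t w) v j = Wbar v j.
Proof.
pose E := Pt t @^-1` [set W].
have mE : measurable E by apply: measurable_funPTI; exact: measurable_mx_set1.
have bE : bounded_rv (\1_E : Omega -> R).
  split; first exact: measurable_indic.
  by exists 1 => w; rewrite indicE ger0_norm ?ler0n// lern1 leq_b1.
have IE : 1%:M != W -> \int[P]_w (\1_E w) = alpha.
  move=> W1; rewrite /Rintegral integral_indic// setIT.
  rewrite -[X in fine X]/(distribution P (Pt t) [set W]) Pt_law; last exact: measurable_mx_set1.
  rewrite !diracE mem_set// memNset; last exact/eqP.
  by rewrite mule1 mule0 adde0.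
have -> : \int[P]_w actual (Pt t w) v j =
    \int[P]_w ((1%:M : 'M[R]_n) v j + (W v j - (1%:M : 'M[R]_n) v j) * \1_E w).
  apply: eq_Rintegral => w _; rewrite indicE /actual_influence.
  have [PW|/eqP PW] := eqVneq (Pt t w) W.
    by rewrite mem_set// mulr1 addrC subrK.
  by rewrite memNset// mulr0 addr0.
rewrite Rintegral_bdD; [|exact: bounded_rv_cst|by apply: bounded_rvM => //; exact: bounded_rv_cst].
rewrite Rintegral_bdZ// Rintegral_prob_cst !mxE.
have [W1|W1] := eqVneq 1%:M W; last by rewrite IE//; lra.
by rewrite -W1 !mxE; lra.
Qed.

(** * The one-step transfer operator *)

(** The Markov operator of the recursion. Extended nonnegative functions allow Tonelli without
    integrability conditions; the choice of time 0 is immaterial by [transferE]. *)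
Definition transfer (f : 'cV[R]_n -> \bar R) (z : 'cV[R]_n) : \bar R :=
  (\int[P]_w f (step (draw 0 w) z))%E.

Lemma transfer_ge0 f : (forall z, 0 <= f z)%E -> forall z, (0 <= transfer f z)%E.
Proof. by move=> f0 z; exact: integral_ge0. Qed.

Lemma measurable_transfer f : measurable_fun setT f -> (forall z, 0 <= f z)%E ->
  measurable_fun setT (transfer f).
Proof.
move=> mf f0.
apply: (measurable_fun_fubini_tonelli_G (m1 := P) (fun wz => f (step (draw 0 wz.1) wz.2))) => //.
apply: measurableT_comp => //; apply: measurable_step => //.
by apply: measurableT_comp => //; exact: measurable_draw.
Qed.

Lemma iter_transfer_ge0 k f : (forall z, 0 <= f z)%E ->
  forall z, (0 <= iter k transfer f z)%E.
Proof. by move=> f0; elim: k => // k IH z; exact: transfer_ge0. Qed.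

Lemma measurable_iter_transfer k f : measurable_fun setT f -> (forall z, 0 <= f z)%E ->
  measurable_fun setT (iter k transfer f).
Proof.
move=> mf f0; elim: k => // k IH.
by apply: measurable_transfer => //; exact: iter_transfer_ge0.
Qed.

(** [Pt t] and [noise t] are independent, so the law of the pair is the product of two marginals
    that do not depend on [t]. *)
Lemma transferE t f z : measurable_fun setT f -> (forall y, 0 <= f y)%E ->
  (\int[P]_w f (step (draw t w) z) = transfer f z)%E.
Proof.
move=> mf f0.
pose h (p : 'M[R]_n * 'cV[R]_n) := f (step (p.1, eta0 + p.2) z).
have mh : measurable_fun setT h.
  apply: measurableT_comp => //; apply: measurable_step => //.
  by apply: measurable_fun_pair => //; exact: measurable_addmx.
have indep t' A B : measurable A -> measurable B ->
    (P (Pt t' @^-1` A `&` noise t' @^-1` B) = P (Pt t' @^-1` A) * P (noise t' @^-1` B))%E.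
  by move=> mA mB; apply: Pt_noise; exact: sigma_process_preimage.
rewrite /transfer -[LHS]/(\int[P]_w h (Pt t w, noise t w))%E.
rewrite -[RHS]/(\int[P]_w h (Pt 0 w, noise 0 w))%E.
rewrite !(integral_independent (@indep _) mh)//; [|by move=> ?; exact: f0..].
transitivity (\int[distribution P (noise t)]_y \int[distribution P (Pt 0)]_x h (x, y))%E.
  apply: eq_integral => y _; apply: eq_measure_integral => A mA _.
  exact: etrans (Pt_law t mA) (esym (Pt_law 0 mA)).
by apply: eq_measure_integral => A mA _; exact: noise_law.
Qed.

Lemma integral_step t f (Y : Omega -> 'cV[R]_n) :
  measurable_fun setT f -> (forall z, 0 <= f z)%E ->
  measurable_fun (setT : set (past t)) Y ->
  (\int[P]_w f (step (draw t w) (Y w)) = \int[P]_w transfer f (Y w))%E.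
Proof.
move=> mf f0 mY.
pose h (p : ('M[R]_n * 'cV[R]_n) * 'cV[R]_n) := f (step p.1 p.2).
have mh : measurable_fun setT h by apply: measurableT_comp => //; exact: measurable_step.
have := tonelli_time Pt_indep noise_indep Pt_noise (@measurable_draw_present t) mY mh
  (fun z => f0 _).
rewrite /h/= => ->; apply: eq_integral => w _.
exact: transferE.
Qed.

(** The outermost map uses draw [k] and the rest only earlier ones. Integrating draw [k] out
    replaces [f] by [transfer f], hence the induction over all [f]. *)
Lemma integral_forward k f y : measurable_fun setT f -> (forall z, 0 <= f z)%E ->
  (\int[P]_w f (forward W lam (draw ^~ w) k y) = iter k transfer f y)%E.
Proof.
elim: k f => [|k IH] f mf f0 /=.
  by rewrite integral_prob_cst.
rewrite (@integral_step k f (fun w => forward W lam (draw ^~ w) k y))//.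
  rewrite IH; [by rewrite -iterS iterSr|exact: measurable_transfer|exact: transfer_ge0].
apply: measurable_forward => // j jk; apply: measurable_draw_past.
by move=> jk'; rewrite jk' ltnn in jk.
Qed.

Lemma integral_backward k s f y : measurable_fun setT f -> (forall z, 0 <= f z)%E ->
  (\int[P]_w f (backward W lam (draw ^~ w) k s y) = iter k transfer f y)%E.
Proof.
elim: k s f => [|k IH] s f mf f0 /=.
  by rewrite integral_prob_cst.
rewrite (@integral_step s f (fun w => backward W lam (draw ^~ w) k s.+1 y))//.
  rewrite IH; [by rewrite -iterS iterSr|exact: measurable_transfer|exact: transfer_ge0].
apply: measurable_backward => // j sj; apply: measurable_draw_past.
by move=> js; rewrite js ltnn in sj.
Qed.

(** The starting time [s] is kept for the proof of invariance: [stationary s.+1] does not involve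
    draw [s], yet has the same law as [stationary s]. *)
Definition stationary (s : nat) (w : Omega) : 'cV[R]_n := backward_limit W lam (draw ^~ w) s.

Lemma measurable_stationary s : measurable_fun setT (stationary s).
Proof.
by apply: measurable_backward_limit => // j _; exact: measurable_draw.
Qed.

Lemma measurable_stationary_past s :
  measurable_fun (setT : set (past s)) (stationary s.+1).
Proof.
apply: measurable_backward_limit => // j sj; apply: measurable_draw_past.
by move=> js; rewrite js ltnn in sj.
Qed.

Lemma stationary_cube s w : in_unit_cube (stationary s w).
Proof. exact: (@backward_limit_cube _ _ _ _ W_stoch lam01 (draw ^~ w) s (input_cube ^~ w)). Qed.

Lemma stationary_step s w : stationary s w = step (draw s w) (stationary s.+1 w).
Proof. exact: (@backward_limit_step _ _ _ _ W_stoch lam01 (draw ^~ w) s (input_cube ^~ w)). Qed.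

Local Notation fwd k y w := (forward W lam (draw ^~ w) k y).

Lemma measurable_fwd k (Y : Omega -> 'cV[R]_n) : measurable_fun setT Y ->
  measurable_fun setT (fun w => fwd k (Y w) w).
Proof.
by move=> mY; apply: measurable_forward => // j _; exact: measurable_draw.
Qed.

Section TestFunctions.
Variables (f : 'cV[R]_n -> R) (c : R).
Hypothesis cf : continuous f.
Hypothesis fc : forall y, `|f y| <= c.

Lemma bounded_test (Y : Omega -> 'cV[R]_n) : measurable_fun setT Y ->
  bounded_rv (fun w => f (Y w)).
Proof.
move=> mY; split; last by exists c.
by apply: measurableT_comp mY; exact: continuous_measurable_mx.
Qed.

(* The forward composition has the law of the backward one, which converges surely. *)
Lemma fwd0_cvg s :
  \int[P]_w f (fwd k 0 w) @[k --> \oo] --> \int[P]_w f (stationary s w).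
Proof.
pose bwd k w := backward W lam (draw ^~ w) k s 0.
(* The transfer identities concern nonnegative functions, hence the shift of [f] by its bound. *)
pose g y := f y + c.
have g0 y : (0 <= (EFin \o g) y)%E.
  by rewrite lee_fin -lerBlDr sub0r; have := fc y; rewrite ler_norml => /andP[].
have mg : measurable_fun setT (EFin \o g).
  apply/measurable_EFinP; apply: measurable_funD => //.
  exact: continuous_measurable_mx.
have mbwd k : measurable_fun setT (bwd k).
  by apply: measurable_backward => // j _; exact: measurable_draw.
have fwd_bwd k : \int[P]_w f (fwd k 0 w) = \int[P]_w f (bwd k w).
  have := etrans (integral_forward k 0 mg g0) (esym (integral_backward k s 0 mg g0)).
  have mfwd : measurable_fun setT (fun w => fwd k 0 w) by exact: measurable_fwd.
  have bcst := bounded_rv_cst Omega c.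
  have bf := bounded_test mfwd; have bb := bounded_test (mbwd k).
  rewrite /g/= (integral_bounded_rv P (bounded_rvD bf bcst)).
  rewrite (integral_bounded_rv P (bounded_rvD bb bcst)).
  by rewrite !Rintegral_bdD// => -[/addIr].
under eq_fun do rewrite fwd_bwd.
apply: bounded_convergence => //.
- by move=> k; have [] := bounded_test (mbwd k).
- by have [] := bounded_test (@measurable_stationary s).
apply: aeW => w; apply: continuous_cvg; first exact: cf.
exact: (@backward_cvg _ _ _ _ W_stoch lam01 (draw ^~ w) s (input_cube ^~ w)).
Qed.

(** Both sides are limits of the same forward expectations, which do not mention [s]. *)
Lemma stationary_test s : \int[P]_w f (stationary s w) = \int[P]_w f (stationary 0 w).
Proof. exact: (norm_cvg_unique (@fwd0_cvg s) (@fwd0_cvg 0)). Qed.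

End TestFunctions.

Lemma stationary_law s A : measurable A ->
  P (stationary s @^-1` A) = P (stationary 0 @^-1` A).
Proof.
pose X i : {mfun Omega >-> 'cV[R]_n} := HB.pack (stationary i)
  (isMeasurableFun.Build _ _ _ _ _ (@measurable_stationary i)).
move=> mA; rewrite -[LHS]/(distribution P (X s) A) -[RHS]/(distribution P (X 0%N) A).
apply: probability_mx_eq mA => f cf f01.
have mf : measurable_fun setT (EFin \o f).
  by apply/measurable_EFinP; exact: continuous_measurable_mx.
have f0 y : (0 <= (EFin \o f) y)%E by rewrite lee_fin; case/andP: (f01 y).
have fc y : `|f y| <= 1 by case/andP: (f01 y) => y0 y1; rewrite ger0_norm.
rewrite !ge0_integral_distribution//.
rewrite !integral_bounded_rv; try exact: (bounded_test cf fc (@measurable_stationary _)).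
by congr EFin; exact: stationary_test.
Qed.

(** [transition] is written with [Pt t] and [transfer] with [actual]; the two events differ by a
    null set. *)
Lemma transition_transfer t y A : measurable A ->
  transition lam eta0 Pt noise t y A = transfer (EFin \o \1_A) y.
Proof.
move=> mA.
have mf : measurable_fun setT (EFin \o \1_A : 'cV[R]_n -> \bar R).
  by apply/measurable_EFinP; exact: measurable_indic.
have f0 z : (0 <= (EFin \o \1_A : 'cV[R]_n -> \bar R) z)%E by rewrite lee_fin.
rewrite -(transferE t y mf f0) /transition.
set E := [set w | _].
have mo : measurable_fun setT (fun w => opinion_step lam (Pt t w) y (eta0 + noise t w)).
  apply: measurable_addmx.
    by apply: measurable_mulmx => //; exact: measurable_mulmx.
  by apply: measurable_mulmx => //; exact: measurable_addmx.
have mE : measurable E.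
  by have := mo measurableT A mA; rewrite setTI.
rewrite -[E in LHS]setIT -integral_indic//.
apply: ge0_ae_eq_integral => //.
- by apply/measurable_EFinP; exact: measurable_indic.
- apply: measurableT_comp => //; apply: measurable_step => //; exact: measurable_draw.
move: ae_actual_influence; apply: filterS => w /= /(_ t) aw _.
by rewrite /random_step /= aw.
Qed.

(** [stationary 0] may be replaced by [stationary 1], which has the same law and is independent of
    draw 0; applying that draw gives back [stationary 0]. *)
Lemma stationary_invariant (xinf : {RV P >-> 'cV[R]_n}) :
  (forall w, xinf w = stationary 0 w) ->
  invariant_distribution lam eta0 Pt noise (distribution P xinf).
Proof.
move=> xE t A mA.
have mf : measurable_fun setT (EFin \o \1_A : 'cV[R]_n -> \bar R).
  by apply/measurable_EFinP; exact: measurable_indic.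
have f0 z : (0 <= (EFin \o \1_A : 'cV[R]_n -> \bar R) z)%E by rewrite lee_fin.
under eq_integral do rewrite transition_transfer//.
pose X i : {mfun Omega >-> 'cV[R]_n} := HB.pack (stationary i)
  (isMeasurableFun.Build _ _ _ _ _ (@measurable_stationary i)).
have xX B : xinf @^-1` B = stationary 0 @^-1` B.
  by apply/seteqP; split=> w /=; rewrite xE.
transitivity (\int[distribution P (X 1%N)]_y transfer (EFin \o \1_A) y)%E.
  apply: eq_measure_integral => B mB _.
  rewrite -[LHS]/(P (xinf @^-1` B)) -[RHS]/(P (stationary 1 @^-1` B)).
  by rewrite stationary_law// xX.
rewrite ge0_integral_distribution//; last 2 first.
- exact: measurable_transfer.
- exact: transfer_ge0.
rewrite -(@integral_step 0 _ (stationary 1) mf f0 (@measurable_stationary_past 0)).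
under eq_integral do rewrite -stationary_step -xE.
rewrite -[RHS]/(P (xinf @^-1` A)) -[xinf @^-1` A in RHS]setIT -integral_indic//.
by rewrite -[X in measurable X]setTI; exact: measurable_funP.
Qed.

(** Extends invariance from sets to functions: the image of [P \x mu] under one step agrees with
    [mu] on measurable sets, so both integrate [f] alike. *)
Lemma invariant_integral_transfer (mu : probability 'cV[R]_n R) f :
  invariant_distribution lam eta0 Pt noise mu ->
  measurable_fun setT f -> (forall z, 0 <= f z)%E ->
  (\int[mu]_y transfer f y = \int[mu]_y f y)%E.
Proof.
move=> inv mf f0.
pose z (wy : Omega * 'cV[R]_n) := step (draw 0 wy.1) wy.2.
have mz : measurable_fun setT z.
  apply: measurable_step => //.
  by apply: measurableT_comp => //; exact: measurable_draw.
pose Z : {mfun (Omega * 'cV[R]_n)%type >-> 'cV[R]_n} := HB.pack z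
  (isMeasurableFun.Build _ _ _ _ _ mz).
have intZ g : measurable_fun setT g -> (forall y, 0 <= g y)%E ->
    (\int[distribution (P \x mu)%E Z]_y g y = \int[mu]_y transfer g y)%E.
  move=> mg g0; rewrite ge0_integral_distribution//.
  by rewrite fubini_tonelli2//=; exact: measurableT_comp.
rewrite -intZ//; apply: eq_measure_integral => A mA _.
have mf1 : measurable_fun setT (EFin \o \1_A : 'cV[R]_n -> \bar R).
  by apply/measurable_EFinP; exact: measurable_indic.
have f10 y : (0 <= (EFin \o \1_A : 'cV[R]_n -> \bar R) y)%E by rewrite lee_fin.
rewrite -[A in LHS]setIT -integral_indic// intZ//.
by under eq_integral do rewrite -(transition_transfer 0)//; exact: inv.
Qed.

Lemma invariant_integral_iter (mu : probability 'cV[R]_n R) f k :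
  invariant_distribution lam eta0 Pt noise mu ->
  measurable_fun setT f -> (forall z, 0 <= f z)%E ->
  (\int[mu]_y iter k transfer f y = \int[mu]_y f y)%E.
Proof.
move=> inv mf f0; elim: k => //= k IH.
rewrite invariant_integral_transfer//; first exact: measurable_iter_transfer.
exact: iter_transfer_ge0.
Qed.

(* Dominates entrywise the difference of two trajectories with the same draws
   whose initial states differ by at most 1. *)
Definition damping (k : nat) (w : Omega) : 'cV[R]_n :=
  forward W lam (fun j => (Pt j w, 0)) k (const_mx 1).

Lemma measurable_damping k : measurable_fun setT (damping k).
Proof.
apply: (measurable_forward W lam (p := fun j w => (Pt j w, 0))
  (y := fun=> const_mx 1)) => // j _.
exact: measurable_fun_pair.
Qed.

Lemma measurable_damping_past k : measurable_fun (setT : set (past k)) (damping k).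
Proof.
apply: (measurable_forward W lam (T := past k) (p := fun j w => (Pt j w, 0))
  (y := fun=> const_mx 1)) => // j jk.
apply: measurable_fun_pair => //; apply: other_times_X.
by move=> jk'; rewrite jk' ltnn in jk.
Qed.

Lemma damping_cube k w : in_unit_cube (damping k w).
Proof.
apply: forward_cube => // [j|v]; first exact: zero_cube.
by rewrite mxE ler01 lexx.
Qed.

Lemma bounded_damping k v : bounded_rv (fun w => damping k w v 0).
Proof.
split; first exact: measurable_mx_coord (@measurable_damping k).
by exists 1 => w; have /andP[d0 d1] := damping_cube k w v; rewrite ger0_norm.
Qed.

Lemma bounded_norm_damping k : bounded_rv (fun w => `|damping k w|).
Proof.
split.
  apply: (measurableT_comp (f := fun y : 'cV[R]_n => `|y|)); last exact: measurable_damping.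
  by apply: continuous_measurable_mx; exact: norm_continuous.
exists 1 => w; rewrite normr_id; apply: mx_norm_le => // v j; rewrite ord1.
by have /andP[d0 d1] := damping_cube k w v; rewrite ger0_norm.
Qed.

(** [damping k] involves only draws before [k], so its products with the influence entries at time
    [k] have factoring expectations. *)
Lemma mean_damping k :
  (\col_v \int[P]_w damping k.+1 w v 0) =
  diag_mx lam *m Wbar *m (\col_v \int[P]_w damping k w v 0).
Proof.
apply/matrixP => v j.
rewrite ord1 -mulmxA mul_diag_mx mxE [RHS]mxE [X in _ * X]mxE.
have bA i : bounded_rv (fun w => actual (Pt k w) v i * damping k w i 0).
  by apply: bounded_rvM; [exact: bounded_actual|exact: bounded_damping].
under eq_Rintegral do rewrite /damping/= /random_step/= opinion_stepE mxE mulr0 addr0.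
rewrite Rintegral_bdZ; last exact: bounded_rv_sum.
rewrite Rintegral_bd_sum//; congr (_ * _); apply: eq_bigr => i _.
rewrite -(mean_actual_influence k) [X in _ = _ * X]mxE.
apply: (expectation_prod_independent (t := k) Pt_indep noise_indep Pt_noise).
- exact: bounded_actual.
- exact: bounded_damping.
- apply: (measurable_mx_coord (f := fun w => actual (Pt k w)) (T := present k)).
  apply: measurableT_comp; first exact: measurable_actual_influence.
  exact: at_time_X.
- exact: (measurable_mx_coord (T := past k)) (@measurable_damping_past k).
Qed.

Lemma ae_damping_cvg0 : {ae P, forall w, `|damping k w| @[k --> \oo] --> (0 : R)}.
Proof.
apply: nonincreasing_ae_cvg0 => //.
- exact: bounded_norm_damping.
- by move=> k w; apply: forward0_norm_nonincreasing.
have r0 : (\col_v \int[P]_w damping 0 w v 0) = const_mx 1.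
  apply/matrixP => v j; rewrite !mxE /damping/=.
  under eq_Rintegral do rewrite mxE.
  by rewrite mxE Rintegral_prob_cst.
have := mean_iter_cvg0 W_stoch lam01 alpha01 alpha0 topologyA r0 mean_damping.
move=> /cvg_mxP r_cvg.
(* The entries are nonnegative, so the norm is at most their sum, whose mean is controlled. *)
have sum0 : \sum_v (\int[P]_w damping k w v 0) @[k --> \oo] --> (0 : R).
  have d0 v : \int[P]_w damping k w v 0 @[k --> \oo] --> (0 : R).
    by have := r_cvg v 0; rewrite mxE; under eq_fun do rewrite mxE.
have := @cvg_sumr R nat \oo _ 'I_n (index_enum 'I_n) _ _ d0.
  rewrite big1_eq; exact.
apply: squeeze_cvgr (cvg_cst 0) sum0; apply: nearW => k.
rewrite Rintegral_ge0//= -Rintegral_bd_sum; last by move=> v; exact: bounded_damping.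
apply: le_Rintegral_bd; first exact: bounded_norm_damping.
  by apply: bounded_rv_sum => v; exact: bounded_damping.
move=> w; apply: mx_norm_le => [|v j].
  by apply: sumr_ge0 => v _; case/andP: (damping_cube k w v).
rewrite ord1 ger0_norm; last by case/andP: (damping_cube k w v).
rewrite (bigD1 v)//= lerDl; apply: sumr_ge0 => i _.
by case/andP: (damping_cube k w i).
Qed.

(** The order of quantifiers matters: the null set is chosen before [y] and [y'], which may
    therefore depend on [w], as the initial state does. *)
Lemma ae_contraction : {ae P, forall w, forall y y' : 'cV[R]_n,
  fwd k y w - fwd k y' w @[k --> \oo] --> (0 : 'cV[R]_n)}.
Proof.
apply: filterS ae_damping_cvg0 => w dw y y'.
apply/norm_cvg0P.
have dw' : `|y - y'| * `|damping k w| @[k --> \oo] --> (0 : R).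
  by rewrite -[X in _ --> X](mulr0 `|y - y'|); apply: cvgM => //; exact: cvg_cst.
apply: squeeze_cvgr (cvg_cst 0) dw'; apply: nearW => k.
rewrite normr_ge0/=; apply: mx_norm_le => [|v j]; first exact: mulr_ge0.
rewrite ord1 !mxE.
have yy' v' : `|y v' 0 - y' v' 0| <= `|y - y'|.
  by have := le_mx_norm (y - y') v' 0; rewrite !mxE.
apply: (le_trans (forwardB W_stoch lam01 (draw ^~ w) k yy' v)).
rewrite ler_wpM2l//; have := le_mx_norm (damping k w) v 0.
by apply: le_trans; exact: ler_norm.
Qed.

(** The comparison is with the trajectory from 0, which stays in the compact cube; the one from [Y]
    may start anywhere. *)
Lemma forward_test_cvg (f : 'cV[R]_n -> R) (c : R) (Y : Omega -> 'cV[R]_n) :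
  continuous f -> (forall y, `|f y| <= c) -> measurable_fun setT Y ->
  \int[P]_w f (fwd k (Y w) w) @[k --> \oo] --> \int[P]_w f (stationary 0 w).
Proof.
move=> cf fc mY.
have b1 k := bounded_test cf fc (measurable_fwd k mY).
have b0 k := bounded_test cf fc (measurable_fwd k (measurable_cst (0 : 'cV[R]_n))).
have bN k : bounded_rv (fun w => -1 * f (fwd k 0 w)).
  by apply: bounded_rvM => //; exact: bounded_rv_cst.
have diff0 : \int[P]_w (f (fwd k (Y w) w) + -1 * f (fwd k 0 w)) @[k --> \oo] --> (0 : R).
  rewrite -[X in _ --> X](Rintegral_prob_cst P 0).
  apply: (@bounded_convergence _ _ _ _ _ _ (c + c)) => //.
  - by move=> k; have [] := bounded_rvD (b1 k) (bN k).
  - by move=> k w; rewrite mulN1r (le_trans (ler_normB _ _))// lerD.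
  apply: filterS ae_contraction => w cw.
  under eq_fun do rewrite mulN1r.
  apply: (continuous_sub_cvg0 (a := fun k => fwd k (Y w) w) (b := fun k => fwd k 0 w)
    (@compact_unit_cube R n) cf) => //.
  by move=> k; apply: forward_cube => //; [move=> j; exact: input_cube|exact: zero_cube].
have -> : (fun k => \int[P]_w f (fwd k (Y w) w)) = (fun k =>
    \int[P]_w (f (fwd k (Y w) w) + -1 * f (fwd k 0 w)) + \int[P]_w f (fwd k 0 w)).
  apply/funext => k; rewrite Rintegral_bdD// Rintegral_bdZ//.
  by rewrite mulN1r subrK.
rewrite -[X in _ --> X]add0r; apply: cvgD => //.
exact: (@fwd0_cvg f c cf fc 0).
Qed.

(** By invariance the integral of [g k] against [mu] is the same for every [k], while [g k]
    converges boundedly, at every starting point, to the constant expectation under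
    [stationary 0]. *)
Lemma invariant_distribution_unique (mu : probability 'cV[R]_n R) A :
  invariant_distribution lam eta0 Pt noise mu -> measurable A ->
  mu A = P (stationary 0 @^-1` A).
Proof.
move=> inv mA.
pose X : {mfun Omega >-> 'cV[R]_n} := HB.pack (stationary 0)
  (isMeasurableFun.Build _ _ _ _ _ (@measurable_stationary 0)).
rewrite -[RHS]/(distribution P X A).
apply: probability_mx_eq mA => f cf f01.
have mf : measurable_fun setT (EFin \o f).
  by apply/measurable_EFinP; exact: continuous_measurable_mx.
have f0 y : (0 <= (EFin \o f) y)%E by rewrite lee_fin; case/andP: (f01 y).
have fc y : `|f y| <= 1 by case/andP: (f01 y) => y0 y1; rewrite ger0_norm.
rewrite ge0_integral_distribution//.
rewrite (integral_bounded_rv P (bounded_test cf fc (@measurable_stationary 0))).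
pose g k (y : 'cV[R]_n) := \int[P]_w f (fwd k y w).
have bf k y := bounded_test cf fc (measurable_fwd k (measurable_cst y)).
have gE k : EFin \o g k = iter k transfer (EFin \o f).
  apply/funext => y; rewrite -integral_forward//=.
  by rewrite (integral_bounded_rv P (bf k y)).
have mg k : measurable_fun setT (g k).
  by apply/measurable_EFinP; rewrite gE; exact: measurable_iter_transfer.
have gc k y : `|g k y| <= 1.
  rewrite ger0_norm; last by apply: Rintegral_ge0 => w _; case/andP: (f01 (fwd k y w)).
  rewrite -[leRHS](Rintegral_prob_cst P); apply: le_Rintegral_bd.
  - exact: bf.
  - exact: bounded_rv_cst.
  - by move=> w; case/andP: (f01 (fwd k y w)).
have bg k : bounded_rv (g k) by split=> //; exists 1.
have intg k : (\int[mu]_y (f y)%:E = (\int[mu]_y g k y)%:E)%E.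
  rewrite -(invariant_integral_iter k inv mf f0) -gE.
  exact: integral_bounded_rv.
have gl : \int[mu]_y g k y @[k --> \oo] -->
    \int[mu]_y (\int[P]_w f (stationary 0 w)).
  apply: (@bounded_convergence _ _ _ _ _ _ 1) => //.
  by apply: aeW => y; apply: forward_test_cvg.
rewrite (intg 0%N); congr EFin.
have g_cst k : \int[mu]_y g k y = \int[mu]_y g 0%N y.
  by apply: EFin_inj; rewrite -!intg.
have := gl; under eq_fun do rewrite g_cst.
rewrite Rintegral_prob_cst => gl'.
exact: (norm_cvg_unique (cvg_cst _) gl').
Qed.

(** * The mean of the limit law *)

Definition mean_forward (k : nat) : 'cV[R]_n := \col_v \int[P]_w fwd k 0 w v 0.

Lemma fwd0_cube k w : in_unit_cube (fwd k 0 w).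
Proof.
by apply: forward_cube => //; [move=> j; exact: input_cube|exact: zero_cube].
Qed.

Lemma bounded_fwd0 k v : bounded_rv (fun w => fwd k 0 w v 0).
Proof.
split; first exact: measurable_mx_coord (measurable_fwd k (measurable_cst _)).
by exists 1 => w; have /andP[x0 x1] := fwd0_cube k w v; rewrite ger0_norm.
Qed.

(** The noise is the difference of two points of the unit cube, [eta0 + noise t w] and [eta0]. *)
Lemma noise_le1 t w v : `|noise t w v 0| <= 1.
Proof.
have /andP[] := input_cube t w v; have /andP[] := eta0_cube v.
by rewrite mxE ler_norml => *; apply/andP; split; lra.
Qed.

Lemma bounded_noise t v : bounded_rv (fun w => noise t w v 0).
Proof.
split; first exact: measurable_mx_coord.
by exists 1 => w; exact: noise_le1.
Qed.

Lemma integral_noise t v : \int[P]_w noise t w v 0 = 0.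
Proof.
have := noise_mean0 t v; rewrite unlock mxE /coordinate.
by rewrite integral_bounded_rv; [case|exact: bounded_noise].
Qed.

Lemma measurable_fwd0_past t k : (k <= t)%N ->
  measurable_fun (setT : set (past t)) (fun w => fwd k 0 w).
Proof.
move=> kt; apply: (measurable_forward W lam (T := past t) (p := draw) (y := fun=> 0)) => // j jk.
apply: measurable_draw_past => jt; move: (leq_trans jk kt).
by rewrite jt ltnn.
Qed.

Lemma mean_forwardS k : mean_forward k.+1 =
  diag_mx lam *m Wbar *m mean_forward k + (1%:M - diag_mx lam) *m eta0.
Proof.
rewrite -[RHS]/(opinion_step lam Wbar (mean_forward k) eta0).
apply/matrixP => v j; rewrite ord1 opinion_stepE mxE.
under eq_Rintegral do rewrite /= /random_step opinion_stepE /= mxE.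
have bA i : bounded_rv (fun w => actual (Pt k w) v i * fwd k 0 w i 0).
  by apply: bounded_rvM; [exact: bounded_actual|exact: bounded_fwd0].
have bS := bounded_rv_sum (index_enum 'I_n) bA.
have bS' : bounded_rv (fun w => lam 0 v * \sum_i actual (Pt k w) v i * fwd k 0 w i 0).
  by apply: bounded_rvM => //; exact: bounded_rv_cst.
have bn : bounded_rv (fun w => eta0 v 0 + noise k w v 0).
  by apply: bounded_rvD; [exact: bounded_rv_cst|exact: bounded_noise].
rewrite Rintegral_bdD//; last by apply: bounded_rvM => //; exact: bounded_rv_cst.
rewrite !Rintegral_bdZ// Rintegral_bdD//; [|exact: bounded_rv_cst|exact: bounded_noise].
rewrite integral_noise Rintegral_prob_cst addr0; congr (_ * _ + _).
rewrite Rintegral_bd_sum//; apply: eq_bigr => i _.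
rewrite -(mean_actual_influence k) [X in _ = _ * X]mxE.
apply: (expectation_prod_independent (t := k) Pt_indep noise_indep Pt_noise).
- exact: bounded_actual.
- exact: bounded_fwd0.
- apply: (measurable_mx_coord (f := fun w => actual (Pt k w)) (T := present k)).
  apply: measurableT_comp; first exact: measurable_actual_influence.
  exact: at_time_X.
- exact: (measurable_mx_coord (T := past k)) (@measurable_fwd0_past k k (leqnn k)).
Qed.

Lemma mean_stationary v : \int[P]_w stationary 0 w v 0 =
  (invmx (1%:M - diag_mx lam *m Wbar) *m (1%:M - diag_mx lam) *m eta0) v 0.
Proof.
(* The coordinates are unbounded test functions, but bounded on the cube. *)
pose clip (i : 'I_n) (y : 'cV[R]_n) : R := Num.max 0 (Num.min 1 (y i 0)).
have cclip i : continuous (clip i).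
  move=> y; apply: (@continuous_max R _ (cst 0) (fun y : 'cV[R]_n => Num.min 1 (y i 0))).
    exact: cst_continuous.
  apply: (@continuous_min R _ (cst 1) (fun y : 'cV[R]_n => y i 0)).
    exact: cst_continuous.
  exact: coord_continuous.
have clip1 i y : `|clip i y| <= 1.
  by rewrite ger0_norm ?le_max ?lexx// ge_max ler01 ge_min lexx.
have clipE i y : in_unit_cube y -> clip i y = y i 0.
  by move=> /(_ i)/andP[y0 y1]; rewrite /clip min_r// max_r.
pose m : 'cV[R]_n := \col_i \int[P]_w stationary 0 w i 0.
have mcvg : mean_forward k @[k --> \oo] --> m.
  apply/cvg_mxP => i j; rewrite ord1 mxE.
  have := @fwd0_cvg _ _ (cclip i) (clip1 i) 0.
  have -> : \int[P]_w clip i (stationary 0 w) = \int[P]_w stationary 0 w i 0.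
    by apply: eq_Rintegral => w _; rewrite clipE//; exact: stationary_cube.
  have -> : (fun k => \int[P]_w clip i (fwd k 0 w)) = (fun k => mean_forward k i 0).
    apply/funext => k; rewrite mxE.
    by apply: eq_Rintegral => w _; rewrite clipE//; exact: fwd0_cube.
  exact.
have mfix : m = diag_mx lam *m Wbar *m m + (1%:M - diag_mx lam) *m eta0.
  have mS : mean_forward k.+1 @[k --> \oo] --> m by rewrite (cvg_shiftS mean_forward).
  have mS' : mean_forward k.+1 @[k --> \oo] -->
      diag_mx lam *m Wbar *m m + (1%:M - diag_mx lam) *m eta0.
    under eq_fun do rewrite mean_forwardS.
    by apply: cvgD; [exact: cvg_mulmxl|exact: cvg_cst].
  exact: (norm_cvg_unique mS mS').
have -> : \int[P]_w stationary 0 w v 0 = m v 0 by rewrite mxE.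
have uA := unitmx_mean W_stoch lam01 alpha01 alpha0 topologyA.
congr ((_ : 'cV[R]_n) v 0); rewrite -[LHS](mulKmx uA) -mulmxA; congr (_ *m _).
by rewrite mulmxBl mul1mx {1}mfix addrC addKr.
Qed.

(** * Vanishing averages of the innovations *)

(** Earlier terms and [V t] do not involve draw [t], while [U t] is centred and depends on that draw
    alone. Hence the next product is orthogonal to the partial sum, as the strong law requires. *)
Lemma ae_mean_present_past (U V : nat -> Omega -> R) (a b : R) :
  (forall t, measurable_fun (setT : set (present t)) (U t)) ->
  (forall t w, `|U t w| <= a) -> (forall t, \int[P]_w U t w = 0) ->
  (forall t k, (k <= t)%N -> measurable_fun (setT : set (past t)) (V k)) ->
  (forall j t, (j < t)%N -> measurable_fun (setT : set (past t)) (U j)) ->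
  (forall t w, `|V t w| <= b) ->
  {ae P, forall w, t%:R^-1 * (\sum_(l < t) U l w * V l w) @[t --> \oo] --> (0 : R)}.
Proof.
move=> mU Ua U0 mV mUpast Vb.
have mU' t : measurable_fun setT (U t).
  exact: measurable_sub_sigma (@at_time_measurable _ _ _ _ _ _ _ _ Pt noise t) (mU t).
have mV' t : measurable_fun setT (V t).
  by apply: measurable_sub_sigma (mV t t (leqnn t)); exact: other_times_measurable.
have bU t : bounded_rv (U t) by split=> //; exists a.
have bV t : bounded_rv (V t) by split=> //; exists b.
have bUV t := bounded_rvM (bU t) (bV t).
apply: (@strong_law_orthogonal _ _ _ P (fun t w => U t w * V t w) (a * b)).
- by move=> t; have [] := bUV t.
- by move=> t w; rewrite normrM ler_pM.
move=> t; pose S w := \sum_(l < t) U l w * V l w.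
have bS : bounded_rv S by apply: bounded_rv_sum => l; exact: bUV.
have -> : \int[P]_w (S w * (U t w * V t w)) = \int[P]_w (U t w * (S w * V t w)).
  by apply: eq_Rintegral => w _; rewrite mulrCA.
rewrite (expectation_prod_independent (t := t) Pt_indep noise_indep Pt_noise).
- by rewrite U0 mul0r.
- exact: bU.
- exact: bounded_rvM.
- exact: mU.
apply: (measurable_funM (T := past t)); last exact: mV.
apply: (measurable_sum (T := past t)) => l.
by apply: (measurable_funM (T := past t)); [exact: mUpast|apply: mV; exact: ltnW].
Qed.

(** The martingale increment of the trajectory from 0: the new state minus its conditional mean
    given the draws before [t]. *)
Definition innovation (t : nat) (w : Omega) : 'cV[R]_n :=
  diag_mx lam *m (actual (Pt t w) - Wbar) *m fwd t 0 w +
  (1%:M - diag_mx lam) *m noise t w.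

Lemma fwd_innovation t w : fwd t.+1 0 w =
  diag_mx lam *m Wbar *m fwd t 0 w + (1%:M - diag_mx lam) *m eta0 + innovation t w.
Proof.
rewrite /= /random_step /opinion_step /innovation /=.
rewrite mulmxDr (mulmxBr (diag_mx lam)) (mulmxBl (diag_mx lam *m _)).
by rewrite [RHS]addrACA [X in _ = X + _]addrC subrK.
Qed.

(** Each coordinate is a finite linear combination of terms covered by [ae_mean_present_past]: the
    noise against the constant 1, and centred influence entries against entries of the current
    state. *)
Lemma ae_innovation_mean : {ae P, forall w,
  t%:R^-1 *: (\sum_(l < t) innovation l w) @[t --> \oo] --> (0 : 'cV[R]_n)}.
Proof.
have ae_noise v : {ae P, forall w,
    t%:R^-1 * (\sum_(l < t) noise l w v 0 * 1) @[t --> \oo] --> (0 : R)}.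
  apply: (@ae_mean_present_past (fun l w => noise l w v 0) (fun _ _ => 1) 1 1) => //.
  - move=> t; apply: (measurable_mx_coord (T := present t)).
    exact: at_time_Y.
  - by move=> t w; exact: noise_le1.
  - by move=> t; exact: integral_noise.
  - move=> j t jt; apply: (measurable_mx_coord (T := past t)).
    by apply: other_times_Y => jt'; rewrite jt' ltnn in jt.
  - by move=> t w; rewrite normr1.
have ae_influence v i : {ae P, forall w, t%:R^-1 *
    (\sum_(l < t) (actual (Pt l w) v i - Wbar v i) * fwd l 0 w i 0) @[t --> \oo] --> (0 : R)}.
  apply: (@ae_mean_present_past (fun l w => actual (Pt l w) v i - Wbar v i)
    (fun l w => fwd l 0 w i 0) 1 1).
  - move=> t; apply: (measurable_funB (T := present t)) => //.
    apply: (measurable_mx_coord (f := fun w => actual (Pt t w)) (T := present t)).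
    apply: measurableT_comp; first exact: measurable_actual_influence.
    exact: at_time_X.
  - move=> t w; have /andP[a0 a1] := actual_entry_bounds (Pt t w) v i.
    have sW := mean_influence_stoch W_stoch alpha01.
    have /row_stochasticP[W0 W1] := sW.
    have w1 : Wbar v i <= 1 by rewrite -(W1 v) (bigD1 i)//= lerDl sumr_ge0.
    by have w0 := W0 v i; rewrite ler_norml; apply/andP; split; lra.
  - move=> t; rewrite Rintegral_bdD; [|exact: bounded_actual|exact: bounded_rv_cst].
    by rewrite mean_actual_influence Rintegral_prob_cst subrr.
  - move=> t k kt; apply: (measurable_mx_coord (T := past t)).
    exact: measurable_fwd0_past.
  - move=> j t jt; apply: (measurable_funB (T := past t)) => //.
    apply: (measurable_mx_coord (f := fun w => actual (Pt j w)) (T := past t)).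
    apply: measurableT_comp; first exact: measurable_actual_influence.
    by apply: other_times_X => jt'; rewrite jt' ltnn in jt.
  - by move=> t w; have /andP[x0 x1] := fwd0_cube t w i; rewrite ger0_norm.
have {}ae_noise : {ae P, forall w, forall v : 'I_n,
    t%:R^-1 * (\sum_(l < t) noise l w v 0 * 1) @[t --> \oo] --> (0 : R)}.
  exact: filter_forall.
have {}ae_influence : {ae P, forall w, forall vi : 'I_n * 'I_n, t%:R^-1 *
    (\sum_(l < t) (actual (Pt l w) vi.1 vi.2 - Wbar vi.1 vi.2) * fwd l 0 w vi.2 0)
      @[t --> \oo] --> (0 : R)}.
  by apply: filter_forall => -[v i]; exact: ae_influence.
move: ae_influence; apply: filterS2 ae_noise => w hn hi.
apply/cvg_mxP => v j; rewrite ord1 [X in _ --> X]mxE.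
have -> : (fun t => (t%:R^-1 *: (\sum_(l < t) innovation l w)) v 0) = (fun t =>
    lam 0 v * (\sum_i t%:R^-1 *
      (\sum_(l < t) (actual (Pt l w) v i - Wbar v i) * fwd l 0 w i 0)) +
    (1 - lam 0 v) * (t%:R^-1 * (\sum_(l < t) noise l w v 0 * 1))).
  apply/funext => t; rewrite mxE summxE.
  have innE l : innovation l w v 0 = lam 0 v * (\sum_i
      (actual (Pt l w) v i - Wbar v i) * fwd l 0 w i 0) + (1 - lam 0 v) * noise l w v 0.
    (* By conversion the innovation is itself one step, with matrix [actual (Pt l w) - Wbar] and the
       noise as input. *)
    rewrite -[innovation l w]/(opinion_step lam _ _ _) opinion_stepE.
    by under eq_bigr do rewrite mxE [X in _ + X]mxE.
  under eq_bigr do rewrite innE.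
  rewrite big_split/= -!mulr_sumr mulrDr exchange_big/=.
  have -> : \sum_(l < t) noise l w v 0 * 1 = \sum_(l < t) noise l w v 0.
    by apply: eq_bigr => l _; rewrite mulr1.
  by congr (_ + _); rewrite mulrCA.
have hsum : \sum_i t%:R^-1 * (\sum_(l < t) (actual (Pt l w) v i - Wbar v i) *
    fwd l 0 w i 0) @[t --> \oo] --> (0 : R).
  have := @cvg_sumr R nat \oo _ 'I_n (index_enum 'I_n) _ _ (fun i => hi (v, i)).
  by rewrite big1_eq; exact.
have := cvgD (cvgM (cvg_cst (lam 0 v)) hsum) (cvgM (cvg_cst (1 - lam 0 v)) (hn v)).
by rewrite !mulr0 addr0; exact.
Qed.

(** * From the trajectory started at 0 to the opinion process *)

Section States.
Variable x : nat -> {RV P >-> 'cV[R]_n}.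
Hypothesis xS : forall t w,
  x t.+1 w = opinion_step lam (Pt t w) (x t w) (eta0 + noise t w).

Lemma ae_state_forward : {ae P, forall w, forall t, x t w = fwd t (x 0%N w) w}.
Proof.
apply: filterS ae_actual_influence => w aw; elim=> //= t IH.
by rewrite xS /random_step /= aw -IH.
Qed.

Lemma state_cvg_in_distribution (xinf : {RV P >-> 'cV[R]_n}) :
  (forall w, xinf w = stationary 0 w) -> cvg_in_distribution P x xinf.
Proof.
move=> xE f cf [c fc].
have intE (Y : Omega -> 'cV[R]_n) : measurable_fun setT Y ->
    ('E_P[fun w => f (Y w)] = (\int[P]_w f (Y w))%:E)%E.
  by move=> mY; rewrite unlock; exact/integral_bounded_rv/(bounded_test cf fc).
rewrite intE// (_ : (fun t => 'E_P[fun w => f (x t w)]%E) =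
  (fun t => (\int[P]_w f (x t w))%:E)); last by apply/funext => t; rewrite intE.
suff key : \int[P]_w f (x t w) @[t --> \oo] --> \int[P]_w f (xinf w).
  by apply: cvg_EFin; [exact: nearW|exact: key].
have -> : (fun t => \int[P]_w f (x t w)) = (fun t => \int[P]_w f (fwd t (x 0%N w) w)).
  apply/funext => t; congr fine; apply: ae_eq_integral => //.
  - apply/measurable_EFinP; apply: measurableT_comp => //; exact: continuous_measurable_mx.
  - apply/measurable_EFinP; apply: measurableT_comp; first exact: continuous_measurable_mx.
    exact: measurable_fwd.
  move: ae_state_forward; apply: filterS => w /= /(_ t) xw _.
  by rewrite -xw.
rewrite (_ : \int[P]_w f (xinf w) = \int[P]_w f (stationary 0 w)).
  exact: (forward_test_cvg cf fc).
by apply: eq_Rintegral => w _; rewrite xE.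
Qed.

Lemma stationary_has_mean (xinf : {RV P >-> 'cV[R]_n}) :
  (forall w, xinf w = stationary 0 w) ->
  has_mean P xinf (invmx (1%:M - diag_mx lam *m Wbar) *m (1%:M - diag_mx lam) *m eta0).
Proof.
move=> xE v; rewrite -mean_stationary unlock -integral_bounded_rv.
  by apply: eq_integral => w _; rewrite /coordinate xE.
split; first exact: measurable_mx_coord (@measurable_stationary 0).
by exists 1 => w; have /andP[x0 x1] := stationary_cube 0 w v; rewrite ger0_norm.
Qed.

(** The process differs from the trajectory started at 0 by a sequence tending to 0, whose Cesaro
    means vanish; the averages of that trajectory come from [affine_recursion_mean]. *)
Lemma ae_state_mean : {ae P, forall w, t%:R^-1 *: (\sum_(l < t) x l w) @[t --> \oo] -->
  invmx (1%:M - diag_mx lam *m Wbar) *m (1%:M - diag_mx lam) *m eta0}.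
Proof.
have uA := unitmx_mean W_stoch lam01 alpha01 alpha0 topologyA.
move: ae_innovation_mean ae_contraction ae_state_forward.
apply: filterS3 => w inn contr xE.
have fwd_mean : t%:R^-1 *: (\sum_(l < t) fwd l 0 w) @[t --> \oo] -->
    invmx (1%:M - diag_mx lam *m Wbar) *m ((1%:M - diag_mx lam) *m eta0).
  have fwd_le1 k : `|fwd k 0 w| <= 1.
    apply: mx_norm_le => // v j; rewrite ord1.
    by have /andP[x0 x1] := fwd0_cube k w v; rewrite ger0_norm.
  exact: (affine_recursion_mean uA (fwd_innovation ^~ w) fwd_le1 inn).
have -> : (fun t => t%:R^-1 *: (\sum_(l < t) x l w)) = (fun t =>
    t%:R^-1 *: (\sum_(l < t) fwd l 0 w) +
    t%:R^-1 *: (\sum_(l < t) (fwd l (x 0%N w) w - fwd l 0 w))).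
  apply/funext => t; rewrite -scalerDr -big_split/=; congr (_ *: _).
  by apply: eq_bigr => l _; rewrite addrC subrK -xE.
rewrite -[X in _ --> X]addr0 -mulmxA.
exact: (cvgD fwd_mean (cesaro_vector (contr (x 0%N w) 0))).
Qed.

End States.

End Model.

Theorem theorem1 (R : realType) (d : measure_display)
    (Omega : measurableType d) (P : probability Omega R)
    (n : nat) (n_ge3 : (3 <= n)%N)
    (W : 'M[R]_n) (W_stoch : row_stochastic W)
    (lam : 'rV[R]_n) (lam01 : forall v, 0 <= lam 0 v <= 1)
    (alpha : R) (alpha01 : 0 <= alpha <= 1)
                                                                          
                                                
    (alpha0 : alpha = 0 -> forall v, lam 0 v < 1)
    (eta0 : 'cV[R]_n) (eta0_cube : in_unit_cube eta0)
    (sigma : 'I_n -> R)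
    (noise : nat -> {RV P >-> 'cV[R]_n})
    (u : nat -> Omega -> 'cV[R]_n)
    (eta : nat -> Omega -> 'cV[R]_n)
    (etaE : forall t w, eta t w = eta0 + noise t w + u t w)
    (eta_cube : forall t w, in_unit_cube (eta t w))
    (Pt : nat -> {RV P >-> 'M[R]_n})
    (x : nat -> {RV P >-> 'cV[R]_n})
    (x0_cube : forall w, in_unit_cube (x 0%N w))
    (xS : forall t w, x t.+1 w = opinion_step lam (Pt t w) (x t w) (eta t w))
    (Pt_random : random_influence W alpha Pt noise (x 0%N))
    (u0 : forall t w, u t w = 0)
    (noiseA : noise_assumption noise x sigma)
    (topologyA : topology_assumption W lam) :
  exists xinf : {RV P >-> 'cV[R]_n},
    [/\ [/\ cvg_in_distribution P x xinf,
            invariant_distribution lam eta0 Pt noise (distribution P xinf) &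
            forall mu : probability 'cV[R]_n R,
              invariant_distribution lam eta0 Pt noise mu ->
              forall A, measurable A -> mu A = distribution P xinf A],
        ergodic P x xinf &
        let Wbar := (1 - alpha) *: 1%:M + alpha *: W in
        let L := diag_mx lam in
        1%:M - L *m Wbar \in unitmx /\
        has_mean P xinf (invmx (1%:M - L *m Wbar) *m (1%:M - L) *m eta0)].
Proof.
have [Pt_law Pt_indep Pt_noise _] := Pt_random.
have [noise_indep noise_law _ noise_mean0 _ _] := noiseA.
have etaN t w : eta t w = eta0 + noise t w by rewrite etaE u0 addr0.
have input_cube t w : in_unit_cube (eta0 + noise t w) by rewrite -etaN.
have xN t w : x t.+1 w = opinion_step lam (Pt t w) (x t w) (eta0 + noise t w).
  by rewrite xS etaN.
have mS := measurable_stationary Pt W_stoch lam01 input_cube 0.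
pose xinf : {mfun Omega >-> 'cV[R]_n} :=
  HB.pack (stationary W lam eta0 Pt noise 0) (isMeasurableFun.Build _ _ _ _ _ mS).
have xinfE w : xinf w = stationary W lam eta0 Pt noise 0 w by [].
have mean_xinf := stationary_has_mean W_stoch lam01 alpha01 alpha0 topologyA Pt_law
  Pt_indep noise_indep Pt_noise noise_law noise_mean0 input_cube eta0_cube
  (xinf := xinf) xinfE.
exists xinf; split.
- split.
  + exact: (state_cvg_in_distribution W_stoch lam01 alpha01 alpha0 topologyA Pt_law
      Pt_indep noise_indep Pt_noise noise_law input_cube xN xinfE).
  + exact: (stationary_invariant W_stoch lam01 Pt_law Pt_indep noise_indep Pt_noise
      noise_law input_cube xinfE).
  + move=> mu inv A mA.
    exact: (invariant_distribution_unique W_stoch lam01 alpha01 alpha0 topologyA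
      Pt_law Pt_indep noise_indep Pt_noise noise_law input_cube inv mA).
- exists (invmx (1%:M - diag_mx lam *m mean_influence W alpha) *m
    (1%:M - diag_mx lam) *m eta0); first exact: mean_xinf.
  exact: (ae_state_mean W_stoch lam01 alpha01 alpha0 topologyA Pt_law
    Pt_indep noise_indep Pt_noise noise_mean0 input_cube eta0_cube xN).
- split; last exact: mean_xinf.
  exact: (unitmx_mean W_stoch lam01 alpha01 alpha0 topologyA).
Qed.
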